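(* Let $\lambda \subseteq \mu$ be partitions such that the skew shape $\mu\backslash\lambda$ consists of exactly two boxes that are not contained in a single row or a single column, and let $k$ be the axial distance between these two boxes. Let $\mathcal S$ be the semisimple tensor category of polynomial representations of $\mathrm{GL}(\infty)$ over $\mathbb{C}$, with simple objects indexed by partitions, and let $\square$ be the simple object indexed by the partition $(1)$. Let $j_\mu^{\lambda,\square,\square}$ be the $2\times 2$ matrix of $6j$ symbols for $\mathcal{S}(\mu,\lambda\otimes\square\otimes\square)$, with the two bases $(v_\nu,v_{\nu'})$ and $(w_{(2)},w_{(1,1)})$ ordered as in the context. Then, for suitable normalization of the tree basis vectors, $$ (j_\mu^{\lambda,\square,\square})^{-1}=\begin{pmatrix} \dfrac{k}{k+1} & \dfrac{-k}{k-1}\\[2mm] 1 & 1\end{pmatrix}, $$ that is, $w_{(2)}=\frac{k}{k+1}v_\nu+v_{\nu'}$ and $w_{(1,1)}=\frac{-k}{k-1}v_\nu+v_{\nu'}$. These $6j$ symbols are uniquely defined up to scaling: each of $v_\nu,v_{\nu'},w_{(2)},w_{(1,1)}$ is determined up to a nonzero scalar, so for any other choice of tree basis vectors $(j_\mu^{\lambda,\square,\square})^{-1}$ is obtained from the matrix above by multiplying on the left and on the right by invertible diagonal matrices.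
   Context: The category $\mathcal S$. Let $S$ be the category with objects the natural numbers and morphisms $S(m,n)=S_m$ (the symmetric group, with simple reflections $g_1,\dots,g_{m-1}$) if $m=n$, and $0$ otherwise (linearized over $\mathbb{C}$), with tensor structure $m\otimes n=m+n$ given on morphisms by the inclusion $S_m\times S_n\to S_{m+n}$, $g_i\otimes g_j\mapsto g_i g_{m+j}$. $\mathcal S$ is the idempotent completion of $S$ (with finite direct sums) inside the category $[S^{\mathrm{op}},\mathbf{Vec}]$ of functors to vector spaces, with monoidal structure given by Day convolution. Concretely, an object of $\mathcal S$ is a finitely supported sequence $(V_n)_{n\ge 0}$ of finite-dimensional complex representations $V_n$ of $S_n$, and the tensor product is the induction product $(V\otimes W)_n=\bigoplus_{a+b=n}\mathrm{Ind}_{S_a\times S_b}^{S_n}(V_a\otimes W_b)$. It is equivalent to the category of polynomial representations of $\mathrm{GL}(\infty)$. The simple objects are indexed by partitions (a partition of $n$ corresponds to the irreducible representation of $S_n$ it labels, with $(n)$ the trivial and $(1^n)$ the sign representation), and tensor products of simples decompose by the Littlewood–Richardson rule; in particular $\lambda\otimes\square=\bigoplus\mu$ over all partitions $\mu\supset\lambda$ with one more box. One has $\square\otimes\square\cong(2)\oplus(1,1)$ and $\mathrm{End}(\square\otimes\square)=\mathbb{C}[S_2]$, with generator $g_1$ acting by $1$ on $(2)$ and by $-1$ on $(1,1)$. $\mathcal S(A,B)$ denotes the space of morphisms $A\to B$; associators are suppressed from the notation. Axial distance. If the two boxes of $\mu\backslash\lambda$ are in positions (row, column) $(r_1,c_1)$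 and $(r_2,c_2)$ with $r_1<r_2$ and $c_1>c_2$, the axial distance is $k=(r_2-r_1)+(c_1-c_2)$. The two bases and the $6j$ symbols. Since the two boxes of $\mu\backslash\lambda$ are not in a single row or column, there are exactly two partitions strictly between $\lambda$ and $\mu$: let $\nu$ be $\lambda$ together with the upper-right box $(r_1,c_1)$, and $\nu'$ be $\lambda$ together with the lower-left box $(r_2,c_2)$. The space $\mathcal S(\mu,\lambda\otimes\square\otimes\square)$ is 2-dimensional. For $\alpha\in\{\nu,\nu'\}$, the left tree basis vector $v_\alpha$ is the composite $\mu\to\alpha\otimes\square\to(\lambda\otimes\square)\otimes\square$ of a nonzero morphism $\mu\to\alpha\otimes\square$ with (nonzero morphism $\alpha\to\lambda\otimes\square$) $\otimes\,\mathrm{id}_\square$. For $\beta\in\{(2),(1,1)\}$, the right tree basis vector $w_\beta$ is the composite $\mu\to\lambda\otimes\beta\to\lambda\otimes(\square\otimes\square)$ of a nonzero morphism $\mu\to\lambda\otimes\beta$ with $\mathrm{id}_\lambda\otimes$ (nonzero morphism $\beta\to\square\otimes\square$). All the Hom spaces used are one-dimensional, so each tree basis vector is defined up to a nonzero scalar. The $6j$ symbols are the entries of the change of basis matrix $j_\mu^{\lambda,\square,\square}$ between the bases $(v_\nu,v_{\nu'})$ and $(w_{(2)},w_{(1,1)})$, with the convention that the columns of $(j_\mu^{\lambda,\square,\square})^{-1}$ are the coordinates of $w_{(2)}$ and $w_{(1,1)}$, in this order, in the basis $(v_\nu,v_{\nu'})$. Normalization. The basis $(v_\nu,v_{\nu'})$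 is normalized so that $\mathrm{id}_\lambda\otimes g_1$ acts on $\mathcal S(\mu,\lambda\otimes\square\otimes\square)$ by Young's semi-normal form $$m(g_1)=\begin{pmatrix}-1/k&1\\1-1/k^2&1/k\end{pmatrix},$$ where column $a$ gives the coordinates of the image of the $a$-th basis vector. *)

(* Defs.v *)
From HB Require Import structures.
From mathcomp Require Import all_boot all_order all_fingroup all_algebra.
From mathcomp Require Import complex reals ring.

Set Implicit Arguments.
Unset Strict Implicit.
Unset Printing Implicit Defensive.

Import Order.TTheory GRing.Theory Num.Theory.

Local Open Scope ring_scope.

(* The category S is built as the idempotent completion (Karoubi envelope) of
   the additive hull of the F-linear groupoid of the finite sets 'I_n: the free
   vector space on nbij m n is F[S_n] if m = n and is 0 otherwise. *)
Definition nbij_pred m n (f : {ffun 'I_m -> 'I_n}) := (m == n) && injectiveb f.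
Definition nbij m n := {f : {ffun 'I_m -> 'I_n} | nbij_pred f}.

Fact bcomp_subproof m n p (b : nbij n p) (a : nbij m n) :
  nbij_pred [ffun i => val b (val a i)].
Proof.
case: b a => [b /= /andP[/eqP np /injectiveP b_inj]] [a /= /andP[/eqP mn /injectiveP a_inj]].
apply/andP; split; first by rewrite mn np.
by apply/injectiveP => i j; rewrite !ffunE => /b_inj/a_inj.
Qed.
Definition bcomp m n p (b : nbij n p) (a : nbij m n) : nbij m p :=
  exist (@nbij_pred _ _) _ (bcomp_subproof b a).

Fact btens_subproof m n p q (a : nbij m n) (b : nbij p q) :
  nbij_pred [ffun i : 'I_(m + p) => match split i with
             | inl i1 => lshift q (val a i1)
             | inr i2 => rshift n (val b i2) end].
Proof.
case: a b => [a /= /andP[/eqP mn /injectiveP a_inj]] [b /= /andP[/eqP pq /injectiveP b_inj]].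
apply/andP; split; first by rewrite mn pq.
apply/injectiveP => i j; rewrite !ffunE.
case: (split_ordP i) => i' ->; case: (split_ordP j) => j' ->.
- by move=> /lshift_inj/a_inj ->.
- by move=> /eqP; rewrite eq_lrshift.
- by move=> /eqP; rewrite eq_rlshift.
- by move=> /rshift_inj/b_inj ->.
Qed.
Definition btens m n p q (a : nbij m n) (b : nbij p q) : nbij (m + p) (n + q) :=
  exist (@nbij_pred _ _) _ (btens_subproof a b).

Fact bperm_subproof n (s : 'S_n) : nbij_pred [ffun i => s i].
Proof.
apply/andP; split=> //; apply/injectiveP => i j.
by rewrite !ffunE => /perm_inj.
Qed.
Definition bperm n (s : 'S_n) : nbij n n := exist (@nbij_pred _ _) _ (bperm_subproof s).

Fact bcast_subproof m n (e : m = n) : nbij_pred [ffun i => cast_ord e i].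
Proof.
apply/andP; split; first by rewrite e.
by apply/injectiveP => i j; rewrite !ffunE => /cast_ord_inj.
Qed.
Definition bcast m n (e : m = n) : nbij m n := exist (@nbij_pred _ _) _ (bcast_subproof e).

(* A family stands for the formal direct sum of its degrees; a morphism of
   families is a matrix of linear combinations of bijections, stored as a
   function on the basis arr X Y of elementary (index, index, bijection)
   arrows. *)
Record nfamily := NFamily { idx : finType; deg : idx -> nat }.
Definition fam1 n := NFamily (fun _ : unit => n).
Definition famtens X Y := NFamily (fun i : idx X * idx Y => deg i.1 + deg i.2)%N.

Definition arr X Y := {ij : idx X * idx Y & nbij (deg ij.1) (deg ij.2)}.
Definition mkarr X Y (i : idx X) (j : idx Y) (b : nbij (deg i) (deg j)) : arr X Y :=
  existT (fun ij : idx X * idx Y => nbij (deg ij.1) (deg ij.2)) (i, j) b.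

Section Morphisms.
Variable F : numFieldType.
Implicit Types X Y Z : nfamily.

Definition mor X Y := {ffun arr X Y -> F^o}.
Definition delta X Y (s : arr X Y) : mor X Y := [ffun t => (t == s)%:R].

(* Bilinear extension of bcomp combined with the matrix product: the entry at
   (i, k, c) sums g b * f a over all factorizations c = b \o a through some j. *)
Definition mcomp X Y Z (g : mor Y Z) (f : mor X Y) : mor X Z :=
  [ffun s => \sum_(j : idx Y)
     \sum_(a : nbij (deg (tag s).1) (deg j))
       \sum_(b : nbij (deg j) (deg (tag s).2) | bcomp b a == tagged s)
         g (mkarr b) * f (mkarr a)].

Definition mtens X Y X' Y' (f : mor X Y) (g : mor X' Y') :
    mor (famtens X X') (famtens Y Y') :=
  [ffun s => \sum_(a : nbij (deg (tag s).1.1) (deg (tag s).2.1))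
     \sum_(b : nbij (deg (tag s).1.2) (deg (tag s).2.2) | btens a b == tagged s)
       f (mkarr a) * g (mkarr b)].

(* 'I_((m + n) + p) and 'I_(m + (n + p)) are different types, so the tensor
   product is strict only up to this explicit associator. *)
Definition massoc X Y Z :
    mor (famtens (famtens X Y) Z) (famtens X (famtens Y Z)) :=
  \sum_(i : idx X) \sum_(j : idx Y) \sum_(k : idx Z)
    delta (@mkarr (famtens (famtens X Y) Z) (famtens X (famtens Y Z))
             ((i, j), k) (i, (j, k)) (bcast (esym (addnA (deg i) (deg j) (deg k))))).

Lemma mcompE X Y Z (g : mor Y Z) (f : mor X Y) i k (c : nbij (deg i) (deg k)) :
  mcomp g f (mkarr c) = \sum_j \sum_(a : nbij (deg i) (deg j))
    \sum_(b : nbij (deg j) (deg k) | bcomp b a == c) g (mkarr b) * f (mkarr a).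
Proof. by rewrite ffunE. Qed.

Lemma mtensE X Y X' Y' (f : mor X Y) (g : mor X' Y') i i' j j'
    (c : nbij (@deg (famtens X X') (i, i')) (@deg (famtens Y Y') (j, j'))) :
  mtens f g (mkarr c) = \sum_(a : nbij (deg i) (deg j))
    \sum_(b : nbij (deg i') (deg j') | btens a b == c) f (mkarr a) * g (mkarr b).
Proof. by rewrite ffunE. Qed.

Lemma morP X Y (f g : mor X Y) :
  (forall i j (b : nbij (deg i) (deg j)), f (mkarr b) = g (mkarr b)) <-> f = g.
Proof. by split=> [fg|-> //]; apply/ffunP => -[[i j] b]; apply: fg. Qed.

Lemma nbijP m n (a b : nbij m n) : val a =1 val b <-> a = b.
Proof. by split=> [ab|-> //]; apply/val_inj/ffunP. Qed.

Lemma btens_comp m n p m' n' p' (b : nbij n p) (a : nbij m n)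
    (b' : nbij n' p') (a' : nbij m' n') :
  bcomp (btens b b') (btens a a') = btens (bcomp b a) (bcomp b' a').
Proof.
apply/nbijP => i /=; rewrite !ffunE.
case: (split_ordP i) => i' _; rewrite !ffunE.
  case: split_ordP => [j /lshift_inj <-|j /eqP] //.
  by rewrite eq_lrshift.
case: split_ordP => [j /eqP|j /rshift_inj <-] //.
by rewrite eq_rlshift.
Qed.

Lemma mcomp_is_linear X Y Z (g : mor Y Z) : linear (fun f : mor X Y => mcomp g f).
Proof.
move=> x f f'; apply/ffunP => s; rewrite !ffunE scaler_sumr -big_split /=.
apply: eq_bigr => j _; rewrite scaler_sumr -big_split /=.
apply: eq_bigr => a _; rewrite scaler_sumr -big_split /=.
apply: eq_bigr => b _; rewrite !ffunE mulrDr; congr (_ + _).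
by rewrite /GRing.scale /= mulrCA.
Qed.
HB.instance Definition _ X Y Z g :=
  GRing.isLinear.Build F (mor X Y) (mor X Z) _ (@mcomp X Y Z g) (mcomp_is_linear g).

Lemma mcomp_is_linearl X Y Z (f : mor X Y) : linear (fun g : mor Y Z => mcomp g f).
Proof.
move=> x g g'; apply/ffunP => s; rewrite !ffunE scaler_sumr -big_split /=.
apply: eq_bigr => j _; rewrite scaler_sumr -big_split /=.
apply: eq_bigr => a _; rewrite scaler_sumr -big_split /=.
apply: eq_bigr => b _; rewrite !ffunE mulrDl; congr (_ + _).
by rewrite /GRing.scale /= mulrA.
Qed.

Definition mcompr X Y Z (f : mor X Y) (g : mor Y Z) := mcomp g f.
HB.instance Definition _ X Y Z f :=
  GRing.isLinear.Build F (mor Y Z) (mor X Z) _ (@mcompr X Y Z f) (mcomp_is_linearl f).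

Lemma mcompZl X Y Z x (g : mor Y Z) (f : mor X Y) :
  mcomp (x *: g) f = x *: mcomp g f.
Proof. exact: (linearZ_LR (mcompr f)). Qed.

Lemma mcomp_suml X Y Z I (r : seq I) (G : I -> mor Y Z) (f : mor X Y) :
  mcomp (\sum_(i <- r) G i) f = \sum_(i <- r) mcomp (G i) f.
Proof. exact: (linear_sum (mcompr f)). Qed.

Lemma mcompZr X Y Z x (g : mor Y Z) (f : mor X Y) :
  mcomp g (x *: f) = x *: mcomp g f.
Proof. exact: linearZ_LR. Qed.

Lemma mcomp_sumr X Y Z I (r : seq I) (g : mor Y Z) (G : I -> mor X Y) :
  mcomp g (\sum_(i <- r) G i) = \sum_(i <- r) mcomp g (G i).
Proof. exact: linear_sum. Qed.

Lemma mcomp_weak X Y Z (g : mor Y Z) (f : mor X Y) i k (phi : nbij (deg i) (deg k) -> F) :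
  \sum_c mcomp g f (mkarr c) * phi c = \sum_j \sum_(a : nbij (deg i) (deg j))
    \sum_(b : nbij (deg j) (deg k)) g (mkarr b) * f (mkarr a) * phi (bcomp b a).
Proof.
under eq_bigr do rewrite mcompE mulr_suml.
rewrite exchange_big; apply: eq_bigr => j _.
under eq_bigr do rewrite mulr_suml.
rewrite exchange_big; apply: eq_bigr => a _.
under eq_bigr do rewrite mulr_suml big_mkcond.
rewrite exchange_big; apply: eq_bigr => b _.
by rewrite -big_mkcond /= (big_pred1 (bcomp b a)) // => c; rewrite eq_sym.
Qed.

Lemma mtens_weak X Y X' Y' (f : mor X Y) (g : mor X' Y') i i' j j'
    (phi : nbij (@deg (famtens X X') (i, i')) (@deg (famtens Y Y') (j, j')) -> F) :
  \sum_c mtens f g (mkarr c) * phi c = \sum_(a : nbij (deg i) (deg j))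
    \sum_(b : nbij (deg i') (deg j')) f (mkarr a) * g (mkarr b) * phi (btens a b).
Proof.
under eq_bigr do rewrite mtensE mulr_suml.
rewrite exchange_big; apply: eq_bigr => a _.
under eq_bigr do rewrite mulr_suml big_mkcond.
rewrite exchange_big; apply: eq_bigr => b _.
by rewrite -big_mkcond /= (big_pred1 (btens a b)) // => c; rewrite eq_sym.
Qed.

Lemma bcompA m n p q (c : nbij p q) (b : nbij n p) (a : nbij m n) :
  bcomp c (bcomp b a) = bcomp (bcomp c b) a.
Proof. by apply/nbijP => i; rewrite !ffunE. Qed.

Lemma mcompA X Y Z W (h : mor Z W) (g : mor Y Z) (f : mor X Y) :
  mcomp h (mcomp g f) = mcomp (mcomp h g) f.
Proof.
apply/morP => i l d; rewrite !mcompE.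
transitivity (\sum_k \sum_j \sum_(a : nbij (deg i) (deg j))
    \sum_(b : nbij (deg j) (deg k)) \sum_(c : nbij (deg k) (deg l))
     g (mkarr b) * f (mkarr a) *
       ((bcomp c (bcomp b a) == d)%:R * h (mkarr c))).
  apply: eq_bigr => k _.
  transitivity (\sum_e mcomp g f (mkarr e) * \sum_(c : nbij (deg k) (deg l))
     ((bcomp c e == d)%:R * h (mkarr c))).
    apply: eq_bigr => e _; rewrite mulr_sumr [LHS]big_mkcond /=.
    by apply: eq_bigr => c _; case: eqP => _; rewrite ?mul0r ?mulr0 // mul1r mulrC.
  rewrite mcomp_weak.
  by do 3!apply: eq_bigr => ? _; rewrite mulr_sumr.
rewrite exchange_big; apply: eq_bigr => j _.
rewrite exchange_big; apply: eq_bigr => a _.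
transitivity (\sum_c mcomp h g (mkarr c) * ((bcomp c a == d)%:R * f (mkarr a))); last first.
  rewrite [RHS]big_mkcond /=; apply: eq_bigr => e _.
  by case: eqP => _; rewrite ?mul0r ?mulr0 // mul1r.
rewrite mcomp_weak; apply: eq_bigr => k _; apply: eq_bigr => b _.
apply: eq_bigr => c _; rewrite bcompA.
have mul4 (x y z t : F) : x * y * (z * t) = t * x * (z * y) by ring.
exact: mul4.
Qed.

Lemma mtens_comp X Y Z X' Y' Z' (g : mor Y Z) (f : mor X Y)
    (g' : mor Y' Z') (f' : mor X' Y') :
  mcomp (mtens g g') (mtens f f') = mtens (mcomp g f) (mcomp g' f').
Proof.
apply/morP => -[i i'] [k k'] d; rewrite mcompE mtensE.
transitivity (\sum_j \sum_j' \sum_(a : nbij (deg i) (deg j))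
  \sum_(a' : nbij (deg i') (deg j')) \sum_(b : nbij (deg j) (deg k))
  \sum_(b' : nbij (deg j') (deg k')) g (mkarr b) * f (mkarr a) *
    (g' (mkarr b') * f' (mkarr a') *
      (btens (bcomp b a) (bcomp b' a') == d)%:R)).
  rewrite pair_big_dep; apply: eq_bigr => -[j j'] _ /=.
  transitivity (
    \sum_(A : nbij (@deg (famtens X X') (i, i')) (@deg (famtens Y Y') (j, j')))
      mtens f f' (mkarr A) *
    \sum_(B : nbij (@deg (famtens Y Y') (j, j')) (@deg (famtens Z Z') (k, k')))
      mtens g g' (mkarr B) * (bcomp B A == d)%:R).
    apply: eq_bigr => A _; rewrite mulr_sumr [LHS]big_mkcond /=.
    by apply: eq_bigr => B _; case: eqP => _; rewrite ?mulr0 // mulr1 mulrC.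
  rewrite mtens_weak; apply: eq_bigr => a _; apply: eq_bigr => a' _.
  rewrite mtens_weak mulr_sumr; apply: eq_bigr => b _.
  rewrite mulr_sumr; apply: eq_bigr => b' _; rewrite btens_comp.
  have mul5 (x y z t u : F) : x * y * (z * t * u) = z * x * (t * y * u) by ring.
  exact: mul5.
transitivity (\sum_c mcomp g f (mkarr c) * \sum_c' mcomp g' f' (mkarr c') *
    (btens c c' == d)%:R); last first.
  apply: eq_bigr => c _; rewrite mulr_sumr [RHS]big_mkcond /=.
  by apply: eq_bigr => c' _; case: eqP => _; rewrite ?mulr0 // mulr1.
rewrite mcomp_weak; apply: eq_bigr => j _.
under [RHS]eq_bigr do under eq_bigr do rewrite mcomp_weak mulr_sumr.
under [RHS]eq_bigr do rewrite exchange_big /=.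
rewrite [RHS]exchange_big /=; apply: eq_bigr => j' _.
apply: eq_bigr => a _.
rewrite [LHS]exchange_big; apply: eq_bigr => b _.
rewrite mulr_sumr; apply: eq_bigr => a' _.
by rewrite mulr_sumr.
Qed.

End Morphisms.

Record obj (F : numFieldType) :=
  Obj { fam :> nfamily; idem : mor F fam fam; idemP : mcomp idem idem = idem }.

Section Objects.
Variable F : numFieldType.
Implicit Types A B C D : obj F.

(* Morphisms A -> B of the idempotent completion are the f fixed by
   f |-> idem B \o f \o idem A; in particular idem A is the identity of A. *)
Definition sandwich A B (f : mor F A B) : mor F A B :=
  mcomp (idem B) (mcomp f (idem A)).
Definition hom_space A B : {vspace mor F A B} := fixedSpace (linfun (@sandwich A B)).

Lemma sandwich_is_linear A B : linear (@sandwich A B).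
Proof. by move=> x f g; rewrite /sandwich mcomp_is_linearl linearP. Qed.
HB.instance Definition _ A B :=
  GRing.isLinear.Build F (mor F A B) (mor F A B) _ (@sandwich A B)
    (@sandwich_is_linear A B).

Lemma memhom A B (f : mor F A B) : (f \in hom_space A B) = (sandwich f == f).
Proof. by apply/fixedSpaceP/eqP; rewrite lfunE. Qed.

Fact tens_subproof A B :
  mcomp (mtens (idem A) (idem B)) (mtens (idem A) (idem B)) = mtens (idem A) (idem B).
Proof. by rewrite mtens_comp !idemP. Qed.
Definition tens A B := Obj (tens_subproof A B).

Definition assoc A B C : mor F (tens (tens A B) C) (tens A (tens B C)) :=
  mcomp (massoc F A B C) (idem (tens (tens A B) C)).

End Objects.

(* Young diagrams are filled by 0, 1, ..., n - 1 in row reading order: the entry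
   i lies in row reshape_index sh i and in column reshape_offset sh i. *)
Definition rowstab sh := [set s : 'S_(sumn sh) |
  [forall i, reshape_index sh (s i) == reshape_index sh i]].
Definition colstab sh := [set s : 'S_(sumn sh) |
  [forall i, reshape_offset sh (s i) == reshape_offset sh i]].

Section Tableau.
Variable sh : seq nat.
Local Notation n := (sumn sh).
Local Notation row := (reshape_index sh).
Local Notation col := (reshape_offset sh).
Implicit Types (i j : 'I_n) (g s t : 'S_n).
Local Notation P := (rowstab sh).
Local Notation Q := (colstab sh).

Lemma row_lt (i : 'I_n) : (row i < size sh)%N.
Proof. exact: reshape_indexP. Qed.

Lemma col_lt (i : 'I_n) : (col i < nth 0%N sh (row i))%N.
Proof. exact: reshape_offsetP. Qed.

Lemma rowcol_inj (i j : 'I_n) : row i = row j -> col i = col j -> i = j.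
Proof.
move=> rij cij; apply: val_inj => /=.
by rewrite -(reshape_indexK sh i) rij cij reshape_indexK.
Qed.

Lemma cellP r c : (c < nth 0 sh r)%N -> exists i : 'I_n, row i = r /\ col i = c.
Proof.
move=> lt_c; have lt_r : (r < size sh)%N.
  by rewrite ltnNge; apply: contraL lt_c => /(nth_default 0%N) ->.
have lt_f : (flatten_index sh r c < n)%N.
  rewrite /flatten_index -[X in (_ < sumn X)%N](cat_take_drop r) sumn_cat ltn_add2l.
  by rewrite (drop_nth 0%N) //= (leq_trans lt_c) // leq_addr.
exists (Ordinal lt_f); split; first exact: flatten_indexKl.
exact: flatten_indexKr.
Qed.

Lemma rowstabP s : reflect (forall i : 'I_n, row (s i) = row i) (s \in P).
Proof. by rewrite inE; apply: (iffP forallP) => h i; apply/eqP/h. Qed.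

Lemma colstabP s : reflect (forall i : 'I_n, col (s i) = col i) (s \in Q).
Proof. by rewrite inE; apply: (iffP forallP) => h i; apply/eqP/h. Qed.

Fact rowstab_group_set : group_set P.
Proof.
apply/group_setP; split=> [|s t /rowstabP hs /rowstabP ht].
  by apply/rowstabP => i; rewrite perm1.
by apply/rowstabP => i; rewrite permM ht hs.
Qed.
Canonical rowstab_group := Group rowstab_group_set.

Fact colstab_group_set : group_set Q.
Proof.
apply/group_setP; split=> [|s t /colstabP hs /colstabP ht].
  by apply/colstabP => i; rewrite perm1.
by apply/colstabP => i; rewrite permM ht hs.
Qed.
Canonical colstab_group := Group colstab_group_set.

Lemma row_col_stab_trivial s : s \in P -> s \in Q -> s = 1%g.
Proof.
move=> /rowstabP hP /colstabP hQ; apply/permP => i; rewrite perm1.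
exact: rowcol_inj.
Qed.

Let cellset (f : 'I_n -> nat) r c := [set i : 'I_n | (row i == r) && (f i < c)%N].

Let card_cellset f c :
  #|[set i : 'I_n | (f i < c)%N]| = (\sum_(r < size sh) #|cellset f r c|)%N.
Proof.
rewrite -sum1_card (partition_big (fun i => Ordinal (row_lt i)) predT) //=.
apply: eq_bigr => r _; rewrite -sum1_card; apply: eq_bigl => i.
by rewrite !inE andbC -val_eqE.
Qed.

Lemma row_col_factor g :
    (forall i j : 'I_n, row i = row j -> col (g i) = col (g j) -> i = j) ->
  exists2 p, p \in P & exists2 q, q \in Q & g = (p * q)%g.
Proof.
move=> g_inj; pose f i := col (g i).
have le_card r c : (#|cellset f r c| <= #|cellset (fun i => col i) r c|)%N.
  have [le_c|lt_c] := leqP c (nth 0%N sh r); last first.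
    apply/subset_leq_card/subsetP => i; rewrite !inE => /andP[/eqP ri _].
    by rewrite ri eqxx (ltn_trans _ lt_c) // -ri col_lt.
  apply: (@leq_trans c).
    rewrite cardE -(size_map f) -[X in (_ <= X)%N](size_iota 0) uniq_leq_size //.
      rewrite map_inj_in_uniq ?enum_uniq // => i j; rewrite !mem_enum !inE.
      by move=> /andP[/eqP ri _] /andP[/eqP rj _]; apply: g_inj; rewrite ri rj.
    by move=> x /mapP[i + ->]; rewrite mem_enum inE mem_iota => /andP[].
  rewrite [X in (_ <= X)%N]cardE -(size_map (fun i : 'I_n => col i)) -[X in (X <= _)%N](size_iota 0).
  rewrite uniq_leq_size ?iota_uniq // => x; rewrite mem_iota add0n /= => lt_x.
  have [i [ri ci]] := cellP (leq_trans lt_x le_c).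
  by apply/mapP; exists i; rewrite ?mem_enum ?inE ?ri ?ci ?eqxx.
have eq_tot c : #|[set i : 'I_n | (f i < c)%N]| = #|[set i : 'I_n | (col i < c)%N]|.
  suff e : [set i : 'I_n | (col i < c)%N] = g @: [set i : 'I_n | (f i < c)%N].
    by rewrite e card_imset //; apply: perm_inj.
  apply/setP => i; rewrite inE; apply/idP/imsetP => [lt_i|[j + ->]].
    by exists (g^-1 i)%g; rewrite ?inE /f permKV.
  by rewrite inE.
have eq_card r c : (r < size sh)%N -> #|cellset f r c| = #|cellset (fun i => col i) r c|.
  move=> lt_r; have := eq_tot c; rewrite !card_cellset => eq_s.
  have [_ /esym] := leqif_sum (fun (i : 'I_(size sh)) (_ : true) =>
    leqif_eq (le_card i c)).
  by rewrite eq_s eqxx => /forall_inP/(_ (Ordinal lt_r) isT)/eqP.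
have lt_f i : (f i < nth 0 sh (row i))%N.
  set r := row i; set c := nth 0%N sh r.
  have sub : cellset f r c \subset cellset (fun i => col i) r c.
    apply/subsetP => j; rewrite !inE => /andP[/eqP rj _].
    by rewrite rj eqxx /c -rj col_lt.
  have /setP/(_ i) : cellset f r c = cellset (fun i => col i) r c.
    by apply/eqP; rewrite eqEcard sub eq_card ?row_lt /=.
  by rewrite !inE eqxx !andTb => ->; apply: col_lt.
have h i : exists j : 'I_n, (row j == row i) && (col j == f i).
  by have [j [rj cj]] := cellP (lt_f i); exists j; rewrite rj cj !eqxx.
pose p0 i := xchoose (h i).
have rp0 i : row (p0 i) = row i by have /andP[/eqP] := xchooseP (h i).
have cp0 i : col (p0 i) = f i by have /andP[_ /eqP] := xchooseP (h i).
have p0_inj : injective p0.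
  move=> i j eq_p; apply: g_inj; first by rewrite -(rp0 i) -(rp0 j) eq_p.
  by rewrite -[LHS](cp0 i) -[RHS](cp0 j) eq_p.
exists (perm p0_inj); first by apply/rowstabP => i; rewrite permE.
exists ((perm p0_inj)^-1 * g)%g; last by rewrite mulKVg.
apply/colstabP => i; rewrite permM -[in RHS](permKV (perm p0_inj) i).
by rewrite [in RHS]permE cp0.
Qed.

Definition conv (x y : 'S_n -> int) s : int := \sum_t x t * y (t^-1 * s)%g.
Definition star (x : 'S_n -> int) s := x (s^-1)%g.
Definition rowsym s : int := (s \in P)%:R.
Definition colsym s : int := (-1) ^+ s * (s \in Q)%:R.
Definition yform := conv colsym rowsym.

Lemma convA x y z : conv x (conv y z) =1 conv (conv x y) z.
Proof.
move=> s; rewrite /conv.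
under [RHS]eq_bigr do rewrite mulr_suml.
rewrite [RHS]exchange_big; apply: eq_bigr => t _ /=.
rewrite mulr_sumr [RHS](reindex_inj (mulgI t)) /=; apply: eq_bigr => u _.
by rewrite mulKg invMg mulrA !mulgA.
Qed.

Lemma eq_conv x x' y y' : x =1 x' -> y =1 y' -> conv x y =1 conv x' y'.
Proof. by move=> xx yy s; apply: eq_bigr => t _; rewrite xx yy. Qed.

Lemma star_conv x y : star (conv x y) =1 conv (star y) (star x).
Proof.
move=> s; rewrite /star /conv [RHS](reindex_inj (mulgI s)).
by apply: eq_bigr => t _; rewrite invMg mulgKV invgK mulrC.
Qed.

Lemma conv_rowsym : conv rowsym rowsym =1 fun s => #|P|%:Z * rowsym s.
Proof.
move=> s; rewrite /conv /rowsym.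
transitivity (\sum_(t in P) (s \in P)%:R : int); last first.
  by rewrite sumr_const -[LHS]mulr_natl natz.
rewrite [RHS]big_mkcond; apply: eq_bigr => t _.
by case: ifP => tP; rewrite ?mul0r // mul1r groupMl ?groupV.
Qed.

Lemma conv_colsym : conv colsym colsym =1 fun s => #|Q|%:Z * colsym s.
Proof.
move=> s; rewrite /conv /colsym.
transitivity (\sum_(t in Q) (-1) ^+ s * (s \in Q)%:R : int); last first.
  by rewrite sumr_const -[LHS]mulr_natl natz.
rewrite [RHS]big_mkcond; apply: eq_bigr => t _.
case: ifP => tQ; rewrite ?mulr0 ?mul0r // mulr1 groupMl ?groupV //.
by rewrite odd_permM odd_permV signr_addb !mulrA -signr_addb addbb mul1r.
Qed.

Lemma star_rowsym : star rowsym =1 rowsym.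
Proof. by move=> s; rewrite /star /rowsym groupV. Qed.

Lemma star_colsym : star colsym =1 colsym.
Proof. by move=> s; rewrite /star /colsym groupV odd_permV. Qed.

Lemma star_sqr_eq0 x : conv (star x) x =1 (fun=> 0) -> x =1 (fun=> 0).
Proof.
move=> /(_ 1%g) + s; rewrite /conv /star.
under eq_bigr do rewrite mulg1 -expr2.
move/eqP; rewrite psumr_eq0 => [/allP/(_ s^-1%g)|t _]; last exact: sqr_ge0.
by rewrite mem_index_enum invgK sqrf_eq0 => /(_ isT)/eqP.
Qed.

Lemma conv_colsym_equi y q s : q \in Q ->
  conv colsym y (q * s)%g = (-1) ^+ q * conv colsym y s.
Proof.
move=> qQ; rewrite /conv (reindex_inj (mulgI q)) mulr_sumr.
apply: eq_bigr => t _; rewrite /colsym groupMl // odd_permM signr_addb.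
by rewrite invMg -!mulrA mulgA mulgKV.
Qed.

Lemma conv_rowsym_inv y p s : p \in P ->
  conv y rowsym (s * p)%g = conv y rowsym s.
Proof.
by move=> pP; apply: eq_bigr => t _; rewrite /rowsym mulgA groupMr.
Qed.

Lemma yform1 : yform 1%g = 1.
Proof.
rewrite /yform /conv (bigD1 1%g) //= big1 => [|t t1].
  by rewrite /rowsym /colsym invg1 mulg1 !group1 odd_perm1 !mulr1 addr0.
rewrite /rowsym /colsym mulg1 groupV; case: (boolP (t \in Q)) => tQ; last first.
  by rewrite mulr0 mul0r.
case: (boolP (t \in P)) => tP; last by rewrite mulr0.
by rewrite (row_col_stab_trivial tP tQ) eqxx in t1.
Qed.

Section Equivariant.
Variable x : 'S_n -> int.
Hypothesis xQ : forall q s, q \in Q -> x (q * s)%g = (-1) ^+ q * x s.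
Hypothesis xP : forall p s, p \in P -> x (s * p)%g = x s.

Lemma equivariant0 s (i j : 'I_n) : i != j -> row i = row j ->
  col (s^-1 i)%g = col (s^-1 j)%g -> x s = 0.
Proof.
move=> ij rij cij; set t := tperm i j.
have tP : t \in P.
  by apply/rowstabP => k; rewrite /t; case: tpermP => // ->.
have uQ : (t ^ s^-1)%g \in Q.
  by apply/colstabP => k; rewrite /t tpermJ; case: tpermP => // ->.
have := xP s tP; rewrite conjgCV xQ // odd_permJ odd_tperm ij expr1 mulN1r.
by move/eqP; rewrite eq_sym -addr_eq0 -mulr2n mulrn_eq0 /= => /eqP.
Qed.

End Equivariant.

Lemma yformQ q s : q \in Q -> yform (q * s)%g = (-1) ^+ q * yform s.
Proof. exact: conv_colsym_equi. Qed.

Lemma yformP p s : p \in P -> yform (s * p)%g = yform s.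
Proof. exact: conv_rowsym_inv. Qed.

Lemma equivariant_factor x s :
    (forall q s, q \in Q -> x (q * s)%g = (-1) ^+ q * x s) ->
    (forall p s, p \in P -> x (s * p)%g = x s) ->
  x s = x 1%g * yform s.
Proof.
move=> xQ xP; have [/existsP[i /existsP[j /and3P[ij /eqP rij /eqP cij]]]|h] := boolP
   [exists i : 'I_n, exists j : 'I_n,
     [&& i != j, row i == row j & col (s^-1 i)%g == col (s^-1 j)%g]].
  rewrite (equivariant0 xQ xP ij rij cij).
  by rewrite (equivariant0 yformQ yformP ij rij cij) mulr0.
have /row_col_factor[p pP [q qQ e]] : forall i j : 'I_n, row i = row j ->
    col (s^-1 i)%g = col (s^-1 j)%g -> i = j.
  move=> i j rij cij; apply/eqP; apply: contraR h => ij.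
  by apply/existsP; exists i; apply/existsP; exists j; rewrite ij rij cij !eqxx.
have -> : s = (q^-1 * (1 * p^-1))%g by rewrite mul1g -invMg -e invgK.
have [q'Q p'P] : q^-1%g \in Q /\ p^-1%g \in P by rewrite !groupV.
by rewrite (xQ _ _ q'Q) (yformQ _ q'Q) (xP _ _ p'P) (yformP _ p'P) yform1 mulr1 mulrC.
Qed.

Lemma yform_scale s : conv yform yform s = conv yform yform 1%g * yform s.
Proof.
apply: (equivariant_factor (x := conv yform yform)) => [q u qQ|p u pP].
  by rewrite /yform -!convA conv_colsym_equi.
by rewrite [in LHS]/yform [in RHS]/yform !convA conv_rowsym_inv.
Qed.

Lemma yform_scal_neq0 : conv yform yform 1%g != 0.
Proof.
apply/negP => /eqP c0.
have cc0 : conv yform yform =1 (fun=> 0) by move=> s; rewrite yform_scale c0 mul0r.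
pose y := conv rowsym yform.
have conv0 z w : w =1 (fun=> 0) -> conv z w =1 (fun=> 0).
  by move=> w0 s; rewrite /conv big1 // => t _; rewrite w0 mulr0.
have convZ k z w w' : w =1 (fun s => k * w' s) -> conv z w =1 (fun s => k * conv z w' s).
  move=> ww s; rewrite /conv mulr_sumr; apply: eq_bigr => t _.
  by rewrite ww mulrCA.
have convZl k z z' w : z =1 (fun s => k * z' s) -> conv z w =1 (fun s => k * conv z' w s).
  move=> zz s; rewrite /conv mulr_sumr; apply: eq_bigr => t _.
  by rewrite zz mulrA.
have star_y : star y =1 y.
  move=> s; rewrite /y star_conv (eq_conv (@star_conv _ _) star_rowsym).
  rewrite (eq_conv (eq_conv star_rowsym star_colsym) (frefl _)).
  by rewrite -convA.
have y0 : y =1 (fun=> 0).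
  apply: star_sqr_eq0 => s; rewrite (eq_conv star_y (frefl _)) /y -convA.
  apply: conv0 => {}s; rewrite {1}/yform -convA.
  have e : conv rowsym (conv rowsym yform) =1 (fun s => #|P|%:Z * conv rowsym yform s).
    by move=> {}s; rewrite convA (convZl _ _ _ _ conv_rowsym).
  by rewrite (convZ _ _ _ _ e) convA cc0 mulr0.
have /(_ 1%g) : yform =1 (fun=> 0).
  apply: star_sqr_eq0 => s; rewrite (eq_conv (@star_conv _ _) (frefl _)).
  rewrite (eq_conv (eq_conv star_rowsym star_colsym) (frefl _)) -convA.
  have e : conv colsym yform =1 (fun s => #|Q|%:Z * yform s).
    by move=> {}s; rewrite convA (convZl _ _ _ _ conv_colsym).
  by rewrite (convZ _ _ _ _ e) -/y y0 mulr0.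
by rewrite yform1.
Qed.
End Tableau.

Section Young.
Variables (F : numFieldType).

Definition mperm n (s : 'S_n) : mor F (fam1 n) (fam1 n) :=
  delta F (@mkarr (fam1 n) (fam1 n) tt tt (bperm s)).

(* The Young symmetrizer c = (\sum_p p) (\sum_q sgn(q) q). It satisfies
   c \o c = kappa c with kappa != 0, and its coefficient at 1 is 1, so kappa is
   the coefficient of c \o c at 1. *)
Definition young sh : mor F (fam1 (sumn sh)) (fam1 (sumn sh)) :=
  \sum_(p in rowstab sh) \sum_(q in colstab sh)
    (-1) ^+ q *: mcomp (mperm p) (mperm q).

Definition young_scal sh : F :=
  mcomp (young sh) (young sh) (@mkarr (fam1 _) (fam1 _) tt tt (bperm 1%g)).

Lemma mkarr_eq X Y (i : idx X) (j : idx Y) (b b' : nbij (deg i) (deg j)) :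
  (mkarr b == mkarr b') = (b == b').
Proof. by rewrite -tag_eqE /tag_eq eqxx /= tagged_asE. Qed.

Lemma mpermE n (s : 'S_n) (b : nbij n n) :
  mperm s (@mkarr (fam1 n) (fam1 n) tt tt b) = (b == bperm s)%:R.
Proof. by rewrite ffunE mkarr_eq. Qed.

Lemma bcomp_perm n (s t : 'S_n) : bcomp (bperm s) (bperm t) = bperm (t * s)%g.
Proof. by apply/nbijP => i /=; rewrite !ffunE permM. Qed.

Lemma mperm_comp n (s t : 'S_n) : mcomp (mperm s) (mperm t) = mperm (t * s)%g.
Proof.
apply/morP => -[] [] c; rewrite mcompE (big_pred1 tt) => [|[] //].
transitivity (\sum_(a : nbij n n) \sum_(b : nbij n n | bcomp b a == c)
   (b == bperm s)%:R * (a == bperm t)%:R : F).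
  by apply: eq_bigr => a _; apply: eq_bigr => b _; rewrite 2!mpermE.
rewrite mpermE (bigD1 (bperm t)) //= [X in _ + X]big1 => [|a /negPf ->]; last first.
  by rewrite big1 // => b _; rewrite mulr0.
rewrite addr0 eqxx -bcomp_perm.
under eq_bigr do rewrite mulr1.
rewrite big_mkcond (bigD1 (bperm s)) //= [X in _ + X]big1 => [|b /negPf ->].
  by rewrite addr0 eqxx eq_sym; case: eqP.
by rewrite if_same.
Qed.

Definition group_elt n (x : 'S_n -> int) : mor F (fam1 n) (fam1 n) :=
  \sum_s (x s)%:~R *: mperm s.

Lemma group_elt_comp sh (x y : 'S_(sumn sh) -> int) :
  mcomp (group_elt y) (group_elt x) = group_elt (conv x y).
Proof.
transitivity (\sum_t \sum_s (x t * y s)%:~R *: mperm (t * s)%g).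
  rewrite {2}/group_elt mcomp_sumr; apply: eq_bigr => t _.
  rewrite mcompZr mcomp_suml scaler_sumr; apply: eq_bigr => s _.
  by rewrite mcompZl mperm_comp scalerA -rmorphM.
under eq_bigr => t _ do rewrite (reindex_inj (mulgI t^-1%g)).
rewrite exchange_big /group_elt; apply: eq_bigr => s _.
rewrite /conv rmorph_sum scaler_suml /=; apply: eq_bigr => t _.
by rewrite mulKVg.
Qed.

Lemma youngE sh : young sh = group_elt (@yform sh).
Proof.
rewrite -group_elt_comp [group_elt (@rowsym _)]/group_elt.
rewrite mcomp_suml /young big_mkcond; apply: eq_bigr => p _.
rewrite mcompZl /rowsym; case: ifP => _; last by rewrite scale0r.
rewrite scale1r /group_elt mcomp_sumr big_mkcond; apply: eq_bigr => q _.
rewrite mcompZr /colsym; case: ifP => _; last by rewrite mulr0 scale0r.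
by rewrite mulr1 rmorphXn rmorphN1.
Qed.

Lemma group_elt1 n (x : 'S_n -> int) :
  group_elt x (@mkarr (fam1 _) (fam1 _) tt tt (bperm 1%g)) = (x 1%g)%:~R.
Proof.
rewrite /group_elt sum_ffunE (bigD1 1%g) //= big1 => [|s s1].
  by rewrite addr0 !ffunE eqxx /GRing.scale /= mulr1.
rewrite !ffunE mkarr_eq; case: eqP => [/(congr1 val)/ffunP e|_]; last exact: scaler0.
case/eqP: s1; apply/permP => i.
by have := e i; rewrite !ffunE => ->.
Qed.

Lemma young_idem sh (e := (young_scal sh)^-1 *: young sh) : mcomp e e = e.
Proof.
rewrite /e /young_scal youngE.
have cc : mcomp (group_elt (@yform sh)) (group_elt (@yform sh)) =
    (conv (@yform sh) (@yform sh) 1%g)%:~R *: group_elt (@yform sh).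
  rewrite group_elt_comp /group_elt scaler_sumr; apply: eq_bigr => s _.
  by rewrite yform_scale scalerA rmorphM.
have k0 : (conv (@yform sh) (@yform sh) 1%g)%:~R != 0 :> F.
  by rewrite intr_eq0 yform_scal_neq0.
have -> : (mcomp (group_elt (@yform sh)) (group_elt (@yform sh))
    : {ffun _ -> _}) (@mkarr (fam1 _) (fam1 _) tt tt (bperm 1%g)) =
    (conv (@yform sh) (@yform sh) 1%g)%:~R by rewrite group_elt_comp group_elt1.
by rewrite mcompZr mcompZl cc !scalerA divfK.
Qed.

(* The simple object indexed by the partition sh of n: the irreducible
   representation of S_n generated by the Young symmetrizer of sh. *)
Definition simple_obj sh : obj F := Obj (young_idem sh).
End Young.

Definition is_partition (la : seq nat) := sorted geq la && (0%N \notin la).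

(* Boxes are (row, column) pairs, numbered from 0. *)
Definition diagram (la : seq nat) : pred (nat * nat) :=
  [pred b | (b.2 < nth 0 la b.1)%N].

Section Trees.
Variable F : numFieldType.
Implicit Types A B C D E : obj F.

Definition box : obj F := simple_obj F [:: 1%N].

(* The transposition generating End(box (x) box) = F[S_2]. *)
Definition g1 : mor F (tens box box) (tens box box) :=
  delta F (@mkarr (tens box box) (tens box box) (tt, tt) (tt, tt)
             (bperm (tperm ord0 ord_max : 'S_2))).

Definition left_tree A B C E D (v : mor F D (tens A (tens B C))) : Prop :=
  exists (x : mor F D (tens E C)) (y : mor F E (tens A B)),
    [/\ x \in hom_space D (tens E C), x != 0, y \in hom_space E (tens A B), y != 0
      & v = mcomp (assoc A B C) (mcomp (mtens y (idem C)) x)].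

Definition right_tree A B C E D (w : mor F D (tens A (tens B C))) : Prop :=
  exists (x : mor F D (tens A E)) (z : mor F E (tens B C)),
    [/\ x \in hom_space D (tens A E), x != 0, z \in hom_space E (tens B C), z != 0
      & w = mcomp (mtens (idem A) z) x].

(* Column j holds the coordinates of v_j in the basis w; hence the columns of
   the inverse are the coordinates of the w_j in the basis v. *)
Definition sixj (V : vectType F) (v w : 2.-tuple V) : 'M[F]_2 :=
  \matrix_(i, j) coord w i (tnth v j).

Definition mx22 (a b c d : F) : 'M[F]_2 :=
  \matrix_(i, j) nth 0 (nth [::] [:: [:: a; b]; [:: c; d]] i) j.

Definition seminormal_mx (k : F) : 'M[F]_2 :=
  mx22 (- k^-1) 1 (1 - k^-2) k^-1.

Definition g1_seminormal A D k (v : 2.-tuple (mor F D (tens A (tens box box)))) :=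
  forall j, mcomp (mtens (idem A) g1) (tnth v j) =
    \sum_i seminormal_mx k i j *: tnth v i.

End Trees.

Arguments left_tree {F} A B C E D v.
Arguments right_tree {F} A B C E D w.
Arguments g1_seminormal {F} A D k v.

(* Main.v *)
(* Write e_sh for the Young idempotent of sh.  Then Hom(S mu, S la (x) Y) is
   e_la F[S_m] e_mu, on which the centralizer of S_n in F[S_m] acts irreducibly,
   and this centralizer is generated by the centre of F[S_n], the permutations
   of the last m - n points and the sums J_i = sum_(a < n) (a i).  The sum of all
   transpositions is central, and acts on e_sh by the sum of the contents of the
   boxes of sh.  With m = n + 1 this makes J_n a scalar, so the space has
   dimension at most 1.  With m = n + 2, a tree vector v through nu is an
   eigenvector of J = J_n, with the content of the added box as eigenvalue, and
   the relation J + g J g + g = const shows that the span of v and g v is stable,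
   hence everything.  The two trees are eigenvectors of J for different
   eigenvalues; the same relation and g^2 = 1 then give the diagonal entries of g
   and the product of its off-diagonal entries, while the right trees are the
   eigenvectors of g for 1 and -1. *)
From HB Require Import structures.
Require Import Defs.
From mathcomp Require Import all_boot all_order all_fingroup all_algebra.
From mathcomp Require Import complex reals ring zify.

Set Implicit Arguments.
Unset Strict Implicit.
Unset Printing Implicit Defensive.

Import Order.TTheory GRing.Theory Num.Theory.
Local Open Scope ring_scope.

(** Neither characters nor the Littlewood-Richardson rule are invoked: dimensions come from
    [hom_irreducible], by which a nonzero stable subspace of a Hom space is the whole space. Upper
    bounds reduce to exhibiting a small stable subspace, lower bounds to producing nonzero vectors.
    For left trees these come from [hom_box_neq0]. Right trees need no separate construction: a
    nonzero eigenvector of the swap is fixed by the corresponding idempotent of F[S_2], hence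
    factors through (2) or (1,1). The number k enters as the difference (c1 - r1) - (c2 - r2) of the
    contents of the two boxes. Being at least 2, it keeps 1 - 1/k^2 nonzero, which allows the left
    trees to be rescaled to the seminormal form. Permutations multiply from left to right while
    morphisms compose from right to left, so orders are reversed between the two. *)

Lemma nbij_inj m n (b : nbij m n) : injective (val b).
Proof. by case: b => b /= /andP[_ /injectiveP]. Qed.

Lemma nbij_bij m n (b : nbij m n) : bijective (val b).
Proof.
have /andP[/eqP e _] := valP b.
by apply: inj_card_bij (@nbij_inj _ _ b) _; rewrite !card_ord e.
Qed.

Lemma bcomp1b m n (b : nbij m n) : bcomp (bperm 1) b = b.
Proof. by apply/nbijP => i; rewrite !ffunE perm1. Qed.

Lemma bcompb1 m n (b : nbij m n) : bcomp b (bperm 1) = b.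
Proof. by apply/nbijP => i; rewrite !ffunE perm1. Qed.

Lemma bperm_surj n (b : nbij n n) : exists s, b = bperm s.
Proof.
exists (perm (nbij_inj (b := b))); apply/nbijP => i.
by rewrite ffunE permE.
Qed.

Lemma bperm_inj n : injective (@bperm n).
Proof.
move=> s t /(congr1 val)/ffunP st; apply/permP => i.
by have := st i; rewrite !ffunE.
Qed.

Lemma binvP m n (b : nbij m n) :
  exists2 b', bcomp b' b = bperm 1 & bcomp b b' = bperm 1.
Proof.
have e : m = n by case: b => b /= /andP[/eqP].
case: n / e b => b; have [s ->] := bperm_surj b.
by exists (bperm s^-1); rewrite bcomp_perm ?mulgV ?mulVg.
Qed.

Lemma bcomp_tperm m n (b : nbij m n) i j :
  bcomp b (bperm (tperm i j)) = bcomp (bperm (tperm (val b i) (val b j))) b.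
Proof.
apply/nbijP => k; rewrite !ffunE.
by rewrite inj_tperm //; apply: nbij_inj.
Qed.

Lemma btens_tperm m n (i j : 'I_m) :
  btens (bperm (tperm i j)) (bperm 1) = bperm (tperm (lshift n i) (lshift n j)).
Proof.
apply/nbijP => k /=; rewrite !ffunE; case: split_ordP => k' ->; rewrite !ffunE.
  by rewrite inj_tperm //; apply: lshift_inj.
by rewrite perm1 tpermD // eq_lrshift.
Qed.

Lemma btens_tpermr m n (i j : 'I_n) :
  btens (bperm 1) (bperm (tperm i j)) = bperm (tperm (rshift m i) (rshift m j)).
Proof.
apply/nbijP => k /=; rewrite !ffunE; case: split_ordP => k' ->; rewrite !ffunE.
  by rewrite perm1 tpermD // eq_rlshift.
by rewrite inj_tperm //; apply: rshift_inj.
Qed.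

Lemma btens1 m n : btens (bperm (1 : 'S_m)) (bperm (1 : 'S_n)) = bperm 1.
Proof.
apply/nbijP => k /=; rewrite !ffunE.
by case: split_ordP => k' ->; rewrite !ffunE !perm1.
Qed.

(* Families with a single summand: their morphisms are linear combinations of
   bijections. *)
Structure pfam := PFam {
  pfam_fam :> nfamily; pt : idx pfam_fam; ptP : forall i, i = pt }.

Fact fam1_ptP n (i : idx (fam1 n)) : i = tt. Proof. by case: i. Qed.
Canonical fam1_pfam n := PFam (@fam1_ptP n).

Fact famtens_ptP (X Y : pfam) (i : idx (famtens X Y)) : i = (pt X, pt Y).
Proof. by case: i => i j; rewrite (ptP i) (ptP j). Qed.
Canonical famtens_pfam X Y := PFam (@famtens_ptP X Y).

Notation dg X := (deg (pt X)).

(* Locked because conversion would otherwise compare compositions by unfolding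
   the sums over bijections. *)
HB.lock Definition bmor (F : numFieldType) (X Y : pfam) (b : nbij (dg X) (dg Y)) :
  mor F X Y := delta F (mkarr b).

HB.lock Definition lcomp (F : numFieldType) (X Y Z : nfamily)
  (g : mor F Y Z) (f : mor F X Y) : mor F X Z := mcomp g f.

HB.lock Definition ltens (F : numFieldType) (X Y X' Y' : nfamily)
  (f : mor F X Y) (g : mor F X' Y') : mor F (famtens X X') (famtens Y Y') := mtens f g.

(** * Calculus of linear combinations of bijections *)

Section Mor.
Variable F : numFieldType.
Implicit Types X Y Z : pfam.
Local Notation bm := (@bmor F _ _).

Definition entry X Y (f : mor F X Y) (b : nbij (dg X) (dg Y)) : F := f (mkarr b).

Lemma pmorP X Y (f g : mor F X Y) : entry f =1 entry g -> f = g.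
Proof.
move=> fg; apply/morP => i j; rewrite (ptP i) (ptP j) => b; exact: fg.
Qed.

Lemma entry_bmor X Y (b c : nbij (dg X) (dg Y)) : entry (bm b) c = (c == b)%:R.
Proof. by rewrite /entry bmor.unlock ffunE mkarr_eq. Qed.

Lemma entryZ X Y x (f : mor F X Y) b : entry (x *: f) b = x * entry f b.
Proof. by rewrite /entry ffunE. Qed.

Lemma entryD X Y (f g : mor F X Y) b : entry (f + g) b = entry f b + entry g b.
Proof. by rewrite /entry ffunE. Qed.

Lemma entry_sum X Y I (r : seq I) (P : pred I) (f : I -> mor F X Y) b :
  entry (\sum_(i <- r | P i) f i) b = \sum_(i <- r | P i) entry (f i) b.
Proof. by rewrite /entry sum_ffunE. Qed.

Lemma mor_bmor X Y (f : mor F X Y) : f = \sum_b entry f b *: bm b.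
Proof.
apply: pmorP => c; rewrite entry_sum (bigD1 c) //= big1 => [|b bc].
  by rewrite entryZ entry_bmor eqxx mulr1 addr0.
by rewrite entryZ entry_bmor eq_sym (negPf bc) mulr0.
Qed.

Lemma lcomp_is_linear (X Y Z : nfamily) (g : mor F Y Z) : linear (fun f : mor F X Y => lcomp g f).
Proof. by move=> x f f'; rewrite lcomp.unlock linearP. Qed.
HB.instance Definition _ (X Y Z : nfamily) g :=
  GRing.isLinear.Build F (mor F X Y) (mor F X Z) _ (@lcomp F X Y Z g)
    (@lcomp_is_linear X Y Z g).

Lemma lcompZl (X Y Z : nfamily) x (g : mor F Y Z) (f : mor F X Y) :
  lcomp (x *: g) f = x *: lcomp g f.
Proof. by rewrite lcomp.unlock mcompZl. Qed.

Lemma lcompZr (X Y Z : nfamily) x (g : mor F Y Z) (f : mor F X Y) :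
  lcomp g (x *: f) = x *: lcomp g f.
Proof. exact: linearZ_LR. Qed.

Lemma lcompDl (X Y Z : nfamily) (g g' : mor F Y Z) (f : mor F X Y) :
  lcomp (g + g') f = lcomp g f + lcomp g' f.
Proof. by rewrite lcomp.unlock; apply: (linearD (mcompr f)). Qed.

Lemma lcompDr (X Y Z : nfamily) (g : mor F Y Z) (f f' : mor F X Y) :
  lcomp g (f + f') = lcomp g f + lcomp g f'.
Proof. exact: linearD. Qed.

Lemma lcomp_suml (X Y Z : nfamily) I (r : seq I) (g : I -> mor F Y Z) (f : mor F X Y) :
  lcomp (\sum_(i <- r) g i) f = \sum_(i <- r) lcomp (g i) f.
Proof. by rewrite lcomp.unlock mcomp_suml. Qed.

Lemma lcomp_sumr (X Y Z : nfamily) I (r : seq I) (g : mor F Y Z) (f : I -> mor F X Y) :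
  lcomp g (\sum_(i <- r) f i) = \sum_(i <- r) lcomp g (f i).
Proof. exact: linear_sum. Qed.

Lemma lcompA (X Y Z W : nfamily) (h : mor F Z W) (g : mor F Y Z) (f : mor F X Y) :
  lcomp h (lcomp g f) = lcomp (lcomp h g) f.
Proof. by rewrite lcomp.unlock mcompA. Qed.

Lemma ltens_comp (X Y Z X' Y' Z' : nfamily) (g : mor F Y Z) (f : mor F X Y)
    (g' : mor F Y' Z') (f' : mor F X' Y') :
  lcomp (ltens g g') (ltens f f') = ltens (lcomp g f) (lcomp g' f').
Proof. by rewrite lcomp.unlock ltens.unlock mtens_comp. Qed.

Lemma entry_comp X Y Z (g : mor F Y Z) (f : mor F X Y) c :
  entry (lcomp g f) c = \sum_a \sum_(b | bcomp b a == c) entry g b * entry f a.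
Proof.
rewrite lcomp.unlock /entry mcompE (big_pred1 (pt Y)) // => j.
by rewrite /= [j]ptP; apply/esym/eqP.
Qed.

Lemma bmor_comp X Y Z (b : nbij (dg Y) (dg Z)) (a : nbij (dg X) (dg Y)) :
  lcomp (bm b) (bm a) = bm (bcomp b a).
Proof.
apply: pmorP => c; rewrite entry_comp entry_bmor (bigD1 a) //=.
rewrite [X in _ + X]big1 => [|a' /negPf a'a]; last first.
  by rewrite big1 // => b' _; rewrite [X in _ * X]entry_bmor a'a mulr0.
rewrite addr0 big_mkcond (bigD1 b) //= [X in _ + X]big1 => [|b' /negPf b'b].
  by rewrite !entry_bmor !eqxx mulr1 addr0 eq_sym; case: eqP.
by rewrite entry_bmor b'b mul0r if_same.
Qed.

Lemma bmor_perm X (s t : 'S_(dg X)) :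
  lcomp (bm (bperm s)) (bm (bperm t)) = @bmor F X X (bperm (t * s)%g).
Proof. by rewrite bmor_comp bcomp_perm. Qed.

Lemma bmor_permA X Y (s t : 'S_(dg Y)) (f : mor F X Y) :
  lcomp (bm (bperm s)) (lcomp (bm (bperm t)) f) =
  lcomp (@bmor F Y Y (bperm (t * s)%g)) f.
Proof. by rewrite lcompA bmor_perm. Qed.

Lemma bmor_permA3 X Y (s t u : 'S_(dg Y)) (f : mor F X Y) :
  lcomp (bm (bperm s)) (lcomp (bm (bperm t)) (lcomp (bm (bperm u)) f)) =
  lcomp (@bmor F Y Y (bperm (u * t * s)%g)) f.
Proof. by rewrite [X in lcomp _ X]bmor_permA [LHS]bmor_permA. Qed.

Lemma entry_tens X Y X' Y' (f : mor F X Y) (g : mor F X' Y') c :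
  entry (ltens f g) c = \sum_a \sum_(b | btens a b == c) entry f a * entry g b.
Proof. by rewrite ltens.unlock /entry mtensE. Qed.

Lemma bmor_tens X Y X' Y' (a : nbij (dg X) (dg Y)) (b : nbij (dg X') (dg Y')) :
  ltens (bm a) (bm b) =
  @bmor F (famtens_pfam X X') (famtens_pfam Y Y') (btens a b).
Proof.
apply: pmorP => c; rewrite entry_tens entry_bmor (bigD1 a) //=.
rewrite [X in _ + X]big1 => [|a' /negPf a'a]; last first.
  by rewrite big1 // => b' _; rewrite entry_bmor a'a mul0r.
rewrite addr0 big_mkcond (bigD1 b) //= [X in _ + X]big1 => [|b' /negPf b'b].
  by rewrite !entry_bmor !eqxx mulr1 addr0 eq_sym; case: eqP.
by rewrite [X in _ * X]entry_bmor b'b mulr0 if_same.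
Qed.

Lemma lcomp_expand X X' Y Y' (p : mor F Y Y') (f : mor F X Y) (q : mor F X' X) :
  lcomp p (lcomp f q) = \sum_b entry f b *: lcomp p (lcomp (bm b) q).
Proof.
rewrite [f in LHS]mor_bmor lcomp_suml lcomp_sumr; apply: eq_bigr => b _.
by rewrite lcompZl lcompZr.
Qed.

Lemma ltens_is_linearl X Y X' Y' (g : mor F X' Y') :
  linear (fun f : mor F X Y => ltens f g).
Proof.
move=> x f f'; apply: pmorP => c; rewrite entryD entryZ !entry_tens mulr_sumr.
rewrite -big_split; apply: eq_bigr => a _; rewrite mulr_sumr -big_split.
by apply: eq_bigr => b _; rewrite entryD entryZ mulrDl mulrA.
Qed.

Definition ltensl X Y X' Y' (g : mor F X' Y') (f : mor F X Y) := ltens f g.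
HB.instance Definition _ X Y X' Y' g :=
  GRing.isLinear.Build F (mor F X Y) (mor F (famtens X X') (famtens Y Y')) _
    (@ltensl X Y X' Y' g) (ltens_is_linearl g).

Lemma ltens_suml X Y X' Y' I (r : seq I) (f : I -> mor F X Y) (g : mor F X' Y') :
  ltens (\sum_(i <- r) f i) g = \sum_(i <- r) ltens (f i) g.
Proof. exact: (linear_sum (ltensl g)). Qed.

Lemma ltensZl X Y X' Y' x (f : mor F X Y) (g : mor F X' Y') :
  ltens (x *: f) g = x *: ltens f g.
Proof. exact: (linearZ_LR (ltensl g)). Qed.

Lemma ltens_is_linearr X Y X' Y' (f : mor F X Y) :
  linear (fun g : mor F X' Y' => ltens f g).
Proof.
move=> x g g'; apply: pmorP => c; rewrite entryD entryZ !entry_tens mulr_sumr.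
rewrite -big_split; apply: eq_bigr => a _; rewrite mulr_sumr -big_split.
by apply: eq_bigr => b _; rewrite entryD entryZ mulrDr mulrCA.
Qed.
HB.instance Definition _ (X Y X' Y' : pfam) f :=
  GRing.isLinear.Build F (mor F X' Y') (mor F (famtens X X') (famtens Y Y')) _
    (@ltens F X Y X' Y' f) (ltens_is_linearr f).

Lemma ltens_sumr X Y X' Y' I (r : seq I) (f : mor F X Y) (g : I -> mor F X' Y') :
  ltens f (\sum_(i <- r) g i) = \sum_(i <- r) ltens f (g i).
Proof. exact: linear_sum. Qed.

Lemma ltensZr X Y X' Y' x (f : mor F X Y) (g : mor F X' Y') :
  ltens f (x *: g) = x *: ltens f g.
Proof. exact: linearZ_LR. Qed.

Definition mid X : mor F X X := bm (bperm 1).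

Lemma mid_l X Y (f : mor F X Y) : lcomp (mid Y) f = f.
Proof.
rewrite {1}[f]mor_bmor lcomp_sumr [RHS]mor_bmor; apply: eq_bigr => b _.
by rewrite lcompZr bmor_comp bcomp1b.
Qed.

Lemma mid_r X Y (f : mor F X Y) : lcomp f (mid X) = f.
Proof.
rewrite {1}[f]mor_bmor lcomp_suml [RHS]mor_bmor; apply: eq_bigr => b _.
by rewrite lcompZl bmor_comp bcompb1.
Qed.

Lemma mid_tens X Y : ltens (mid X) (mid Y) = mid (famtens_pfam X Y).
Proof. by rewrite bmor_tens btens1. Qed.

(** In degree n this is 1/n! times the trace of the multiplication by [f] on the group algebra,
    whence its cyclicity. *)
Definition tr X (f : mor F X X) : F := entry f (bperm 1).

Lemma trZ X x (f : mor F X X) : tr (x *: f) = x * tr f.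
Proof. exact: entryZ. Qed.

Lemma bcompK m n (b : nbij n m) (a : nbij m n) :
  bcomp b a = bperm 1 -> bcomp a b = bperm 1.
Proof.
have [b' b'b bb'] := binvP b => e; suff -> : a = b' by [].
by rewrite -[LHS]bcomp1b -b'b -bcompA e bcompb1.
Qed.

Lemma tr_mulC X Y (f : mor F Y X) (g : mor F X Y) :
  tr (lcomp f g) = tr (lcomp g f).
Proof.
rewrite /tr !entry_comp.
under eq_bigr do rewrite big_mkcond.
under [RHS]eq_bigr do rewrite big_mkcond.
rewrite exchange_big; apply: eq_bigr => b _; apply: eq_bigr => a _.
have -> : (bcomp b a == bperm 1) = (bcomp a b == bperm 1).
  by apply/eqP/eqP; apply: bcompK.
by rewrite mulrC.
Qed.

Lemma tr_bmor X Y (f : mor F X Y) (b : nbij (dg X) (dg Y)) (b' : nbij (dg Y) (dg X)) :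
  bcomp b' b = bperm 1 -> tr (lcomp (bm b') f) = entry f b.
Proof.
move=> b'b; rewrite [f in LHS]mor_bmor lcomp_sumr /tr entry_sum (bigD1 b) //=.
rewrite big1 => [|c cb]; first by rewrite lcompZr bmor_comp b'b entryZ entry_bmor eqxx mulr1 addr0.
rewrite lcompZr bmor_comp entryZ entry_bmor; case: eqP => [e|_]; last by rewrite mulr0.
by case/eqP: cb; rewrite -[LHS]bcomp1b -(bcompK b'b) -bcompA -e bcompb1.
Qed.

End Mor.

Section Hom.
Variable F : numFieldType.

Lemma lidemP (A : obj F) : lcomp (idem A) (idem A) = idem A.
Proof. by rewrite lcomp.unlock idemP. Qed.

Lemma homP (A B : obj F) (f : mor F A B) :
  reflect (lcomp (idem B) f = f /\ lcomp f (idem A) = f) (f \in hom_space A B).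
Proof.
rewrite memhom lcomp.unlock; apply: (iffP eqP) => [<-|[h1 h2]]; last by rewrite /sandwich h2.
rewrite /sandwich; split; last by rewrite -!mcompA idemP.
by rewrite !mcompA idemP.
Qed.
End Hom.

(** * Schur's lemma for the Young idempotents *)

Section Simple.
Variables (F : numFieldType) (sh : seq nat).
Local Notation n := (sumn sh).
Local Notation e := (idem (simple_obj F sh)).
Local Notation D := (fam1_pfam n).
Local Notation pmor s := (@bmor F D D (bperm s)).
Local Notation bm := (@bmor F _ _).

Lemma mperm_bmor (s : 'S_n) : mperm F s = pmor s.
Proof. by rewrite bmor.unlock. Qed.

Lemma simple_idem : @lcomp F D D D e e = e.
Proof. exact: (lidemP (simple_obj F sh)). Qed.

Definition young_coef : int := conv (@yform sh) (@yform sh) 1%g.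

Lemma young_coef_neq0 : young_coef%:~R != 0 :> F.
Proof. by rewrite intr_eq0 yform_scal_neq0. Qed.

Lemma idem_simpleE : e = young_coef%:~R^-1 *: group_elt F (@yform sh).
Proof. by rewrite /= /young_scal youngE group_elt_comp group_elt1. Qed.

Lemma tr_idem_simple : @tr F D e = young_coef%:~R^-1.
Proof.
by rewrite idem_simpleE trZ /tr /entry group_elt1 yform1 mulr1.
Qed.

(** The product y k y is alternating under left multiplication by column permutations and invariant
    under right multiplication by row permutations, hence a multiple of y by [equivariant_factor].
    Its value at 1 is (y y)(k^-1), again a multiple of y(k^-1). *)
Lemma yform_sandwich (k s : 'S_n) :
  conv (@yform sh) (conv (fun t => (t == k)%:R) (@yform sh)) s =
  young_coef * yform k^-1%g * yform s.
Proof.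
set dk := fun t => _; set x := conv _ _.
have xQ q t : q \in colstab sh -> x (q * t)%g = (-1) ^+ q * x t.
  by move=> qQ; rewrite /x {1 3}/yform -!convA conv_colsym_equi.
have xP p t : p \in rowstab sh -> x (t * p)%g = x t.
  move=> pP; have xE : x =1 conv (conv (@yform sh) (conv dk (@colsym sh))) (@rowsym sh).
    move=> u; rewrite -convA; apply: eq_conv => // w.
    by rewrite /yform -convA.
  by rewrite !xE conv_rowsym_inv.
rewrite (equivariant_factor s xQ xP); congr (_ * _).
rewrite /x -yform_scale /conv (reindex_inj invg_inj).
rewrite (reindex_inj (mulgI k)); apply: eq_bigr => t _ /=.
rewrite mulrC (bigD1 k) //= big1 => [|u /negPf uk]; last by rewrite /dk uk mul0r.
by rewrite /dk eqxx mul1r addr0 mulg1 invgK mulKg invMg.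
Qed.

Lemma simple_perm (k : 'S_n) :
  lcomp e (lcomp (pmor k) e) = (yform k^-1%g)%:~R *: e.
Proof.
have mk : pmor k = group_elt F (fun t : 'S_n => (t == k)%:R).
  rewrite bmor.unlock /group_elt (bigD1 k) //= big1 => [|t /negPf ->]; last by rewrite scale0r.
  by rewrite eqxx scale1r addr0.
rewrite idem_simpleE !lcompZr !lcompZl mk lcomp.unlock !group_elt_comp !scalerA.
have -> : group_elt F (conv (conv (@yform sh) (fun t : 'S_n => (t == k)%:R)) (@yform sh))
    = (young_coef%:~R * (yform k^-1%g)%:~R) *: group_elt F (@yform sh).
  rewrite scaler_sumr; apply: eq_bigr => s _.
  by rewrite -convA yform_sandwich scalerA !rmorphM.
by rewrite scalerA mulrA -(mulrA _ _ young_coef%:~R) mulVf ?young_coef_neq0 // mulr1 mulrC.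
Qed.

Lemma sum_yform_inv : \sum_(k : 'S_n) (@yform sh k)%:~R * (yform k^-1%g)%:~R = young_coef%:~R :> F.
Proof.
rewrite /young_coef /conv rmorph_sum; apply: eq_bigr => k _.
by rewrite mulg1 rmorphM.
Qed.

Lemma simple_schur (x : mor F D D) : exists c, lcomp e (lcomp x e) = c *: e.
Proof.
rewrite [x]mor_bmor lcomp_suml lcomp_sumr.
apply: (big_ind (fun f => exists c, f = c *: e)).
- by exists 0; rewrite scale0r.
- by move=> _ _ [c ->] [d ->]; exists (c + d); rewrite scalerDl.
move=> b _; have [k ->] := bperm_surj b.
by eexists; rewrite lcompZl lcompZr (simple_perm k) scalerA.
Qed.

(** A central [z] commutes with e, so z e = e z e, which [simple_schur] makes a multiple of e. *)
Lemma simple_central (z : mor F D D) :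
  (forall s : 'S_n, lcomp z (pmor s) = lcomp (pmor s) z) ->
  exists c, lcomp z e = c *: e.
Proof.
move=> zC; have [c ec] := simple_schur z; exists c; rewrite -ec.
have ze : lcomp z e = lcomp e z.
  rewrite idem_simpleE lcompZr lcompZl lcomp_sumr lcomp_suml; congr (_ *: _).
  by apply: eq_bigr => s _; rewrite lcompZr lcompZl mperm_bmor zC.
by rewrite lcompA -ze -lcompA simple_idem.
Qed.

(* The trace form (z, y) |-> tr (z \o y) is nondegenerate, and a nonzero trace
   makes the scalar e z y = c e nonzero. *)
Lemma simple_split (X : pfam) (y : mor F D X) :
  lcomp y e = y -> y != 0 -> exists z : mor F X D, lcomp z y = e.
Proof.
move=> ye y0; have [b yb0] : exists b, entry y b != 0.
  apply/existsP; apply: contraNT y0 => /existsPn yb.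
  apply/eqP/pmorP => b; rewrite (eqP (negPn (yb b))).
  by rewrite /entry ffunE.
have [b' b'b _] := binvP b.
have [c ec] := simple_schur (lcomp (bm b') y).
have trc : c * tr e = entry y b.
  rewrite -trZ -ec tr_mulC -(lcompA (bm b')) ye -lcompA ye.
  exact: tr_bmor.
have c0 : c != 0 by apply: contraNneq yb0 => c0; rewrite -trc c0 mul0r.
exists (c^-1 *: lcomp e (bm b')).
by rewrite lcompZl -lcompA -[in lcomp (bm b') y]ye (lcompA (bm b')) ec scalerA mulVf ?scale1r.
Qed.

End Simple.

(** * Generators of the centralizer of a symmetric subgroup *)

(* K plays the role of S_n, acting on the subset S of Om; the sums
   [avg s] = sum_(k in K) s ^ k span the centralizer of K. *)
Section Centralizer.
Variables (F : numFieldType) (Om : finType) (S : {set Om}) (K : {group {perm Om}}).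
Hypothesis K_fix : forall k i, k \in K -> i \notin S -> k i = i.
Hypothesis K_tperm : forall a b, a \in S -> b \in S -> tperm a b \in K.
Variables (W : lmodType F) (rho : {perm Om} -> {linear W -> W}).
Hypothesis rhoM : forall s t w, rho (s * t)%g w = rho t (rho s w).

Definition avg s w := \sum_(k in K) rho (s ^ k)%g w.

Lemma K_stab k a : k \in K -> (k a \in S) = (a \in S).
Proof.
move=> kK; apply/idP/idP; last first.
  apply: contraTT => kaS; have := K_fix (groupVr kK) kaS.
  by rewrite permK => ->.
by apply: contraTT => aS; rewrite K_fix.
Qed.

Lemma avgJ s k w : k \in K -> avg (s ^ k)%g w = avg s w.
Proof.
move=> kK; rewrite /avg [RHS](reindex_inj (mulgI k)) /=.
apply: eq_big => [h|h _]; first by rewrite groupMl.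
by rewrite conjgM.
Qed.

(** K permutes [S] and fixes [i], so it commutes with the sum of the (a i), which can be moved
    inside the average. *)
Lemma sum_tperm_avg s i w : i \notin S ->
  \sum_(a in S) rho (tperm a i) (avg s w) = \sum_(a in S) avg (s * tperm a i)%g w.
Proof.
move=> iS; under eq_bigr do rewrite linear_sum.
rewrite exchange_big [RHS]exchange_big; apply: eq_bigr => k kK.
rewrite (reindex_inj (@perm_inj _ k)) /=.
apply: eq_big => [a|a _]; first by rewrite K_stab.
rewrite -rhoM; congr (rho _ w).
by rewrite conjMg tpermJ (K_fix kK iS).
Qed.

Variable V : W -> Prop.
Hypothesis V_lin : forall c u v, V u -> V v -> V (c *: u + v).
Hypothesis V0 : V 0.
Hypothesis V_stab : forall (s : {perm Om}) w,
  (forall a, a \in S -> s a \in S) -> V w -> V (avg s w).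
Hypothesis V_jm : forall i w, i \notin S -> V w -> V (\sum_(a in S) rho (tperm a i) w).

Let V_sum I (r : seq I) (P : pred I) f :
  (forall i, P i -> V (f i)) -> V (\sum_(i <- r | P i) f i).
Proof.
move=> Vf; apply: big_ind => // u v Vu Vv.
by rewrite -[u]scale1r; apply: V_lin.
Qed.

Let moved (s : {perm Om}) := [set a in S | s a != a].

(* Induction on the number of points of S moved by s: if s sends a in S to i
   outside S, then s = t (a i) where t fixes a, and J_i avg t is the sum of the
   avg (t (b i)), which is avg s when t fixes b and has smaller degree else. *)
Lemma avg_closed s w : V w -> V (avg s w).
Proof.
have [d] := ubnP #|moved s|; elim: d s w => // d IH s w /ltnSE le_d Vw.
have [/forallP stab|] := boolP [forall a, (a \in S) ==> (s a \in S)].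
  by apply: V_stab => // a; apply/implyP.
rewrite negb_forall => /existsP[a]; rewrite negb_imply => /andP[aS].
set i := s a => iS; pose t := (s * tperm a i)%g.
have neq_i b : b \in S -> b != i by move=> bS; apply: contraNneq iS => <-.
have st : s = (t * tperm a i)%g by rewrite /t -mulgA tperm2 mulg1.
have ta : t a = a by rewrite permM tpermR.
have tmoved : moved t \subset moved s :\ a.
  apply/subsetP => b; rewrite !inE => /andP[bS tb].
  have ba : b != a by apply: contraNneq tb => ->; rewrite ta.
  rewrite ba bS; apply: contraNneq tb => sb.
  by rewrite permM sb tpermD // eq_sym // neq_i.
have lt_t : (#|moved t| < #|moved s|)%N.
  rewrite (cardsD1 a (moved s)) !inE aS eq_sym neq_i //= add1n ltnS.
  exact: subset_leq_card.
pose U := [set b in S | t b == b].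
have aU : a \in U by rewrite inE aS ta eqxx.
have avgU b : b \in U -> avg (t * tperm b i)%g w = avg s w.
  rewrite inE => /andP[bS /eqP tb].
  (* Since [t] fixes both [a] and [b], it commutes with (a b); conjugating by this element of K
     turns t (b i) into t (a i) = s. *)
  have <- : ((t * tperm b i) ^ tperm a b)%g = s.
    rewrite st conjMg tpermJ tpermR tpermD ?neq_i //.
    have tab : (tperm a b ^ t)%g = tperm a b by rewrite tpermJ ta tb.
    by congr (_ * _)%g; rewrite conjgE -{2}tab -conjgC mulKg.
  by rewrite avgJ // K_tperm.
have card_U : #|U|%:R != 0 :> F by rewrite pnatr_eq0 -lt0n; apply/card_gt0P; exists a.
have Vt : V (\sum_(b in S) avg (t * tperm b i)%g w).
  rewrite -sum_tperm_avg //; apply: V_jm => //; apply: IH => //.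
  exact: leq_trans lt_t _.
have Vother : V (\sum_(b in S :\: U) avg (t * tperm b i)%g w).
  apply: V_sum => b; rewrite !inE => /andP[tb bS]; apply: IH => //.
  apply: leq_trans le_d; apply: leq_ltn_trans lt_t; apply: subset_leq_card.
  apply/subsetP => c; rewrite !inE => /andP[cS tc]; rewrite cS.
  have [-> //|cb] := eqVneq c b; first by move: tb; rewrite bS.
  apply: contraNneq tc => tc.
  by rewrite permM tc tpermD // eq_sym // neq_i.
(* The points of [U] contribute equal terms [avg s w] to the sum over [S]; solve for this term. *)
have -> : avg s w = #|U|%:R^-1 *: (- 1 *: \sum_(b in S :\: U) avg (t * tperm b i)%g w
   + \sum_(b in S) avg (t * tperm b i)%g w) + 0.
  have /setIidPr US : U \subset S by apply/subsetP => b; rewrite inE => /andP[].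
  rewrite addr0 [X in _ *: (_ + X)](big_setID U) /= US.
  rewrite scaleN1r addrCA addNr addr0 (eq_bigr _ avgU) sumr_const -scaler_nat scalerA.
  by rewrite mulVf ?scale1r.
by apply: (V_lin _ _ V0); apply: V_lin.
Qed.
End Centralizer.

(** * Products of permutations and irreducibility of the Hom spaces *)

Section PermTens.
Variables m n : nat.
Implicit Types (s : 'S_m) (t : 'S_n).

Definition ptens s t : 'S_(m + n) := perm (nbij_inj (b := btens (bperm s) (bperm t))).

Lemma bperm_ptens s t : bperm (ptens s t) = btens (bperm s) (bperm t).
Proof. by apply/nbijP => i; rewrite ffunE permE. Qed.

Lemma ptensM s s' t t' : ptens (s * s') (t * t') = (ptens s t * ptens s' t')%g.
Proof.
by apply: bperm_inj; rewrite -bcomp_perm !bperm_ptens btens_comp !bcomp_perm.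
Qed.

Lemma ptens1 : ptens 1 1 = 1%g.
Proof. by apply: bperm_inj; rewrite bperm_ptens btens1. Qed.

Lemma ptensV s t : ((ptens s t)^-1 = ptens s^-1 t^-1)%g.
Proof. by apply/eqP; rewrite eq_invg_mul -ptensM !mulgV ptens1. Qed.

Lemma ptensl s t i : ptens s t (lshift n i) = lshift n (s i).
Proof.
rewrite permE ffunE; case: split_ordP => j /eqP; last by rewrite eq_lrshift.
by move=> /eqP/lshift_inj <-; rewrite ffunE.
Qed.

Lemma ptensr s t i : ptens s t (rshift m i) = rshift m (t i).
Proof.
rewrite permE ffunE; case: split_ordP => j /eqP; first by rewrite eq_rlshift.
by move=> /eqP/rshift_inj <-; rewrite ffunE.
Qed.

Lemma ptens_tperm (i j : 'I_m) : ptens (tperm i j) 1 = tperm (lshift n i) (lshift n j).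
Proof. by apply: bperm_inj; rewrite bperm_ptens btens_tperm. Qed.

Definition left_ords : {set 'I_(m + n)} := [set lshift n i | i : 'I_m].

Lemma lshift_left i : lshift n i \in left_ords.
Proof. exact: imset_f. Qed.

Definition ext_perms : {set 'S_(m + n)} := [set ptens s 1 | s : 'S_m].

Fact ext_perms_group_set : group_set ext_perms.
Proof.
apply/group_setP; split; first by apply/imsetP; exists 1%g; rewrite ?ptens1.
move=> _ _ /imsetP[s _ ->] /imsetP[t _ ->]; apply/imsetP; exists (s * t)%g => //.
by rewrite -ptensM mulg1.
Qed.
Canonical ext_perms_group := Group ext_perms_group_set.

Lemma ext_perms_fix k i : k \in ext_perms -> i \notin left_ords -> k i = i.
Proof.
move=> /imsetP[s _ ->]; case: (split_ordP i) => j ->; first by rewrite lshift_left.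
by rewrite ptensr perm1.
Qed.

Lemma ext_perms_tperm i j :
  i \in left_ords -> j \in left_ords -> tperm i j \in ext_perms.
Proof.
move=> /imsetP[a _ ->] /imsetP[b _ ->].
by rewrite -ptens_tperm; apply: imset_f.
Qed.

Lemma ptens_injl : injective (fun s => ptens s 1).
Proof.
move=> s s' ss'; apply/permP => i; apply: (@lshift_inj _ n).
by rewrite -!(ptensl _ 1) ss'.
Qed.

Lemma ptens_surj (u : 'S_(m + n)) :
  (forall i, i \in left_ords -> u i \in left_ords) -> exists s t, u = ptens s t.
Proof.
move=> uS; have uL i : exists j, u (lshift n i) == lshift n j.
  by have /imsetP[j _ ->] := uS _ (lshift_left i); exists j.
pose f i := xchoose (uL i); have fE i : u (lshift n i) = lshift n (f i).
  exact/eqP/(xchooseP (uL i)).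
have f_inj : injective f.
  move=> i j fij; apply: (@lshift_inj _ n); apply: (@perm_inj _ u).
  by rewrite !fE fij.
have uR i : exists j, u (rshift m i) == rshift m j.
  case: (split_ordP (u (rshift m i))) => j uj; last by exists j; apply/eqP.
  have := fE ((perm f_inj)^-1%g j); rewrite -[f _](permE f_inj) permKV -uj.
  by move/perm_inj/eqP; rewrite eq_lrshift.
pose g i := xchoose (uR i); have gE i : u (rshift m i) = rshift m (g i).
  exact/eqP/(xchooseP (uR i)).
have g_inj : injective g.
  move=> i j gij; apply: (@rshift_inj m); apply: (@perm_inj _ u).
  by rewrite !gE gij.
exists (perm f_inj), (perm g_inj); apply/permP => i.
by case: (split_ordP i) => j ->; rewrite ?ptensl ?ptensr permE.
Qed.
End PermTens.

Section Irreducible.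
Variables (F : numFieldType) (la mu : seq nat) (Y : pfam).
Local Notation n := (sumn la).
Local Notation D := (fam1_pfam (sumn mu)).
Local Notation T := (famtens_pfam (fam1_pfam n) Y).
Local Notation e := (idem (simple_obj F la)).
Local Notation pmor s := (@bmor F (fam1_pfam n) (fam1_pfam n) (bperm s)).
Local Notation E := (ltens (idem (simple_obj F la)) (mid F Y)).

(** [Y] carries the identity because it will be made of boxes, whose idempotent is the identity
    ([simple1_idem]). *)
Definition in_hom (w : mor F D T) :=
  lcomp E w = w /\ lcomp w (idem (simple_obj F mu)) = w.

Variable V : mor F D T -> Prop.
Hypothesis V0 : V 0.
Hypothesis V_lin : forall c u v, V u -> V v -> V (c *: u + v).
Hypothesis V_hom : forall w, V w -> in_hom w.
Hypothesis V_right : forall (t : 'S_(dg Y)) w, V w ->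
  V (lcomp (ltens (mid F (fam1_pfam n)) (@bmor F Y Y (bperm t))) w).
Hypothesis V_jm : forall (i : 'I_(dg Y)) w, V w ->
  V (lcomp (\sum_(a : 'I_n) @bmor F T T (bperm (tperm (lshift _ a) (rshift n i)))) w).

Let rho (s : 'S_(dg T)) : {linear mor F D T -> mor F D T} :=
  lcomp (@bmor F T T (bperm s)).

Let K := ext_perms_group n (dg Y).

Let sum_K (f : 'S_(dg T) -> mor F D T) :
  \sum_(k in K) f k = \sum_(k : 'S_n) f (ptens k 1).
Proof. by rewrite big_imset //= => k k' _ _; apply: ptens_injl. Qed.

(** Such an [s] is a product of some [s0] on the left points and some [t] on the right ones.
    Averaging affects only [s0] and makes it central in F[S_n], so it acts on e_la by a scalar; the
    action of [t] is covered by [V_right]. *)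
Lemma avg_stab_closed (s : 'S_(dg T)) w :
  (forall i, i \in left_ords n (dg Y) -> s i \in left_ords n (dg Y)) -> V w -> V (avg K rho s w).
Proof.
move=> /ptens_surj[s0 [t ->]] Vw.
set w' := lcomp (ltens (mid F (fam1_pfam n)) (@bmor F Y Y (bperm t))) w.
have Vw' : V w' by apply: V_right.
pose z := \sum_(k : 'S_n) pmor (s0 ^ k)%g.
have zC u : lcomp z (pmor u) = lcomp (pmor u) z.
  rewrite /z lcomp_suml [RHS]lcomp_sumr [LHS](reindex_inj (mulIg u)) /=.
  apply: eq_bigr => k _.
  by rewrite !bmor_perm conjgM -conjgC.
have [c zc] := simple_central zC.
have -> : avg K rho (ptens s0 t) w = c *: w'.
  rewrite /avg sum_K.
  transitivity (lcomp (ltens z (mid F Y)) w').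
    rewrite /z ltens_suml lcomp_suml; apply: eq_bigr => k _.
    rewrite /w' lcompA ltens_comp mid_l mid_r.
    by rewrite bmor_tens -bperm_ptens !conjgE ptensV -!ptensM invg1 mulg1 mul1g.
  have [<- _] := V_hom Vw'.
  by rewrite lcompA ltens_comp mid_l zc ltensZl lcompZl.
by rewrite -[c *: w']addr0; apply: V_lin.
Qed.

Lemma closed_avg s w : V w -> V (avg K rho s w).
Proof.
move: s w; apply: (@avg_closed F _ (left_ords n (dg Y)) K).
- exact: ext_perms_fix.
- exact: ext_perms_tperm.
- move=> s t w; rewrite /rho.
  rewrite [RHS]lcompA.
  rewrite bmor_comp.
  by rewrite bcomp_perm.
- exact: V_lin.
- exact: V0.
- exact: avg_stab_closed.
- move=> i w; case: (split_ordP i) => j ->; first by rewrite lshift_left.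
  move=> _ Vw; have := V_jm j Vw; rewrite lcomp_suml.
  rewrite big_imset //= => a b _ _; exact: lshift_inj.
Qed.

(* Any h is u v with u = h z and z v = e_mu; averaging u over S_n multiplies its
   action by the nonzero scalar [young_coef], as sum_k y(k) y(k^-1) = (y y)(1). *)
Theorem hom_irreducible v h : V v -> v != 0 -> in_hom h -> V h.
Proof.
move=> Vv v0 [Eh hmu]; have [Ev vmu] := V_hom Vv.
have [z zv] := simple_split vmu v0.
have EE : lcomp E E = E by rewrite ltens_comp simple_idem mid_l.
set u := lcomp h (lcomp z E).
have Eu : lcomp E (lcomp u E) = u by rewrite /u -!lcompA EE [LHS]lcompA Eh.
have uv : lcomp u v = h by rewrite /u -!lcompA Ev zv hmu.
have V_E w : V w -> lcomp E w = w by move=> /V_hom[].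
have V_sum I (r : seq I) f : (forall i, V (f i)) -> V (\sum_(i <- r) f i).
  move=> Vf; apply: big_ind => // x y Vx Vy.
  by rewrite -[x]scale1r; apply: V_lin.
pose P (k : 'S_n) := @bmor F T T (bperm (ptens k 1)).
have PE (k : 'S_n) : lcomp E (lcomp (P k) E) = (@yform la k^-1%g)%:~R *: E.
  have -> : P k = ltens (pmor k) (mid F Y).
    by rewrite /P bperm_ptens; apply/esym/bmor_tens.
  rewrite ltens_comp.
  rewrite ltens_comp.
  rewrite (mid_l (mid F Y)).
  rewrite (mid_l (mid F Y)).
  rewrite simple_perm.
  exact: ltensZl.
have Vsum : V (\sum_(k : 'S_n) lcomp (P k^-1%g) (lcomp u (lcomp (P k) v))).
  (* Expanding [u] over bijections turns the sum into a combination of averages applied to [v]. *)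
  have -> : \sum_(k : 'S_n) lcomp (P k^-1%g) (lcomp u (lcomp (P k) v)) =
      \sum_b entry u b *: \sum_(k : 'S_n) lcomp (P k^-1%g) (lcomp (@bmor F _ _ b) (lcomp (P k) v)).
    under [RHS]eq_bigr do rewrite scaler_sumr.
    rewrite exchange_big; apply: eq_bigr => k _.
    exact: lcomp_expand.
  apply: V_sum => b; rewrite -[_ *: _]addr0; apply: V_lin => //.
  have [s ->] := bperm_surj b.
  rewrite (_ : \sum_k _ = avg K rho s v); first exact: closed_avg.
  rewrite /avg sum_K (reindex_inj invg_inj); apply: eq_bigr => k _ /=.
  rewrite invgK.
  rewrite /P.
  apply: etrans (bmor_permA3 _ _ _ v) _.
  congr (lcomp (@bmor F _ _ (bperm _)) v).
  by rewrite conjgE ptensV invg1 mulgA.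
have kuv : \sum_(k : 'S_n) lcomp (P k^-1%g) (lcomp u (lcomp (P k) v)) = (young_coef la)%:~R *: h.
  rewrite -(V_E _ Vsum) lcomp_sumr -(sum_yform_inv F la) scaler_suml.
  apply: eq_bigr => k _; rewrite -{1}Eu -[v in LHS]Ev.
  (* Both [u] and [v] absorb E, so each [P k] may be enclosed between two copies of E, where [PE]
     makes it a scalar. *)
  transitivity (lcomp (lcomp E (lcomp (P k^-1%g) E)) (lcomp u (lcomp (lcomp E (lcomp (P k) E)) v))).
    rewrite !lcompA.
    by [].
  rewrite [X in lcomp X _]PE.
  rewrite PE.
  rewrite invgK lcompZl lcompZl.
  rewrite !lcompZr scalerA.
  by rewrite (V_E v Vv) uv Eh.
have -> : h = (young_coef la)%:~R^-1 *: ((young_coef la)%:~R *: h) + 0.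
  by rewrite addr0 scalerA mulVf ?young_coef_neq0 ?scale1r.
by apply: V_lin => //; rewrite -kuv.
Qed.

End Irreducible.

(** * The central sum of transpositions and its restriction to a product *)

Section Casimir.
Variable F : numFieldType.
Implicit Types X Y : pfam.
Local Notation bm := (@bmor F _ _).

(* Ordered pairs i, j are used, including i = j: this is twice the sum of the
   transpositions plus the degree. *)
Definition cas X : mor F X X := \sum_i \sum_j @bmor F X X (bperm (tperm i j)).

(** A bijection carries a transposition to the transposition of the images, so both sides differ by
    a reindexing. *)
Lemma cas_natural X Y (f : mor F X Y) : lcomp (cas Y) f = lcomp f (cas X).
Proof.
rewrite [f]mor_bmor lcomp_sumr lcomp_suml; apply: eq_bigr => b _.
rewrite lcompZr lcompZl; congr (_ *: _); rewrite lcomp_suml lcomp_sumr.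
have on_bij : {on [pred i | true], bijective (val b)} by apply/onW_bij/nbij_bij.
rewrite (reindex _ on_bij); apply: eq_bigr => i _.
rewrite lcomp_suml lcomp_sumr (reindex _ on_bij); apply: eq_bigr => j _.
by rewrite !bmor_comp bcomp_tperm.
Qed.

(* Jucys-Murphy type sum: the point i of Y is exchanged with each point of X. *)
Definition jm X Y (i : 'I_(dg Y)) : mor F (famtens X Y) (famtens X Y) :=
  \sum_(a : 'I_(dg X))
    @bmor F (famtens_pfam X Y) (famtens_pfam X Y)
      (bperm (tperm (lshift _ a) (rshift (dg X) i))).

(** A pair made of one point of [X] and one of [Y] occurs in both orders, whence the factor 2. *)
Lemma cas_tens X Y :
  cas (famtens_pfam X Y) =
  ltens (cas X) (mid F Y) + ltens (mid F X) (cas Y) + (\sum_i jm X i) *+ 2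
    :> mor F (famtens_pfam X Y) (famtens_pfam X Y).
Proof.
pose t (k l : 'I_(dg X + dg Y)) :=
  @bmor F (famtens_pfam X Y) (famtens_pfam X Y) (bperm (tperm k l)).
transitivity (\sum_i (\sum_j t (lshift _ i) (lshift _ j) + \sum_j t (lshift _ i) (rshift _ j)) +
   \sum_i (\sum_j t (rshift _ i) (lshift _ j) + \sum_j t (rshift _ i) (rshift _ j))).
  rewrite [LHS]big_split_ord; congr (_ + _); apply: eq_bigr => i _; exact: big_split_ord.
rewrite !big_split /= addrA /cas.
have -> : ltens (\sum_i \sum_j @bmor F X X (bperm (tperm i j))) (mid F Y) =
  \sum_i \sum_j t (lshift _ i) (lshift _ j).
  rewrite ltens_suml; apply: eq_bigr => i _; rewrite ltens_suml; apply: eq_bigr => j _.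
  by rewrite bmor_tens btens_tperm.
have -> : ltens (mid F X) (\sum_i \sum_j @bmor F Y Y (bperm (tperm i j))) =
  \sum_i \sum_j t (rshift _ i) (rshift _ j).
  rewrite ltens_sumr; apply: eq_bigr => i _; rewrite ltens_sumr; apply: eq_bigr => j _.
  by rewrite bmor_tens btens_tpermr.
set A := \sum_i _; set B := \sum_i _; set C := \sum_i _; set E := \sum_i _; set J := \sum_i _.
have -> : C = J by rewrite /C exchange_big.
have -> : E = J by do 2!apply: eq_bigr => ? _; rewrite /t tpermC.
by rewrite mulr2n -!addrA; congr (_ + _); rewrite [RHS]addrC -!addrA.
Qed.

Lemma cas_tens_comp X Y Z (w : mor F Z (famtens X Y)) :
  lcomp (cas (famtens_pfam X Y)) w =
  lcomp (ltens (cas X) (mid F Y)) w + lcomp (ltens (mid F X) (cas Y)) w +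
    lcomp (\sum_i jm X i) w *+ 2.
Proof.
rewrite cas_tens; apply: etrans (lcompDl _ _ _) _; congr (_ + _).
  exact: lcompDl.
by rewrite mulr2n; apply: lcompDl.
Qed.

End Casimir.

(** * Contents as coefficients of the Young symmetrizer *)

Section Content.
Variable sh : seq nat.
Local Notation n := (sumn sh).
Local Notation row := (reshape_index sh).
Local Notation col := (reshape_offset sh).

Lemma yform_tperm (i j : 'I_n) : i != j ->
  yform (tperm i j) = (row i == row j)%:R - (col i == col j)%:R.
Proof.
move=> ij; case: eqVneq => rij; case: eqVneq => cij.
- by case/eqP: ij; apply: rowcol_inj.
- rewrite -[tperm i j]mul1g yformP ?yform1 ?subr0 //.
  by apply/rowstabP => k; case: tpermP => // ->.
- rewrite -[tperm i j]mulg1 yformQ ?yform1; last first.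
    by apply/colstabP => k; case: tpermP => // ->.
  by rewrite odd_tperm ij sub0r mulr1 expr1.
rewrite subrr /yform /conv big1 // => u _; rewrite /colsym /rowsym.
have [uQ|_] := boolP (u \in _); last by rewrite mulr0 mul0r.
have [uP|_] := boolP (_ \in rowstab sh); last by rewrite mulr0.
(* In a factorization of (i j) through Q and P, the column permutation [u] moves rows as (i j) does.
   It therefore fixes all other points and cannot place [i] anywhere: not at [i] as the rows differ,
   not at [j] as the columns differ. *)
have urow k : row (tperm i j k) = row (u k).
  have /rowstabP/(_ (u k)) := uP.
  by rewrite permM permK.
have ucol k : col (u k) = col k by have /colstabP := uQ.
have ufix k : k != i -> k != j -> u k = k.
  move=> ki kj; apply: rowcol_inj; last exact: ucol.
  by rewrite -urow tpermD // eq_sym.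
have [ui|ui] := eqVneq (u i) i.
  by case/eqP: rij; have := urow i; rewrite tpermL ui.
have [uj|uj] := eqVneq (u i) j.
  by case/eqP: cij; rewrite -(ucol i) uj.
by have /perm_inj/eqP := ufix _ ui uj; rewrite (negPf ui).
Qed.

(* The eigenvalue of [cas]: the number of boxes plus twice the sum of the usual
   contents. *)
Definition content : int := \sum_(i : 'I_n) \sum_(j : 'I_n) yform (tperm i j).

Definition hook (b b' : nat * nat) : int := (b.1 == b'.1)%:R - (b.2 == b'.2)%:R.

(** A diagonal pair has coefficient y(1) = 1 but vanishing [hook], which accounts for the summand
    n. *)
Lemma contentE : content = n%:Z +
  \sum_(i : 'I_n) \sum_(j : 'I_n) hook (row i, col i) (row j, col j).
Proof.
rewrite -natz -{1}[n]card_ord -sumr_const -big_split; apply: eq_bigr => i _.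
rewrite (bigD1 i) //= [X in _ = _ + X](bigD1 i) //= tperm1 yform1 /hook /=.
rewrite !eqxx subrr add0r; congr (_ + _); apply: eq_bigr => j ji.
by rewrite yform_tperm // eq_sym.
Qed.
End Content.

Section AddBox.

(** The bound [R] pads with empty rows, so that diagrams with different numbers of rows are summed
    over one range. *)
Lemma boxes_sum sh R (G : nat -> nat -> int) : (size sh <= R)%N ->
  \sum_(i < sumn sh) G (reshape_index sh i) (reshape_offset sh i) =
  \sum_(r < R) \sum_(c < nth 0%N sh r) G r c.
Proof.
elim: sh R G => [|a sh IH] R G.
  by rewrite big_ord0 => _; rewrite big1 // => r _; rewrite nth_nil big_ord0.
case: R => // R; rewrite ltnS => le_R; rewrite big_ord_recl /= big_split_ord /=.
congr (_ + _); last rewrite -(IH R (fun r => G r.+1)) //; apply: eq_bigr => i _.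
  have e : i = flatten_index (a :: sh) 0 i :> nat by [].
  by rewrite {1 2}e flatten_indexKl ?flatten_indexKr /=.
have e : (a + i)%N = flatten_index (a :: sh) (reshape_index sh i).+1 (reshape_offset sh i).
  by rewrite -{1}(reshape_indexK sh i) /flatten_index /= addnA.
have lt_c := @col_lt sh i.
by rewrite e flatten_indexKl ?flatten_indexKr.
Qed.

(** Stated on row lengths, with default 0, so that a box opening a new row is not a special case. *)
Definition add_box (sh sh' : seq nat) r :=
  forall r', nth 0%N sh' r' = ((r == r') + nth 0%N sh r')%N.

Variables (sh sh' : seq nat) (r : nat).
Hypothesis box : add_box sh sh' r.
Local Notation c := (nth 0%N sh r).

Lemma add_box_sum (G : nat -> nat -> int) :
  \sum_(i < sumn sh') G (reshape_index sh' i) (reshape_offset sh' i) =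
  \sum_(i < sumn sh) G (reshape_index sh i) (reshape_offset sh i) + G r c.
Proof.
pose R := (r.+1 + size sh + size sh')%N.
have rR : (r < R)%N by rewrite /R -addnA ltn_addr.
rewrite !(@boxes_sum _ R); try by rewrite /R; lia.
rewrite (bigD1 (Ordinal rR)) //= [X in _ = X + _](bigD1 (Ordinal rR)) //=.
rewrite box eqxx add1n big_ord_recr /= addrAC; congr (_ + _ + _).
apply: eq_bigr => r' r'r; rewrite box (_ : (r == r') = false) //.
by apply: contraNF r'r => /eqP e; apply/eqP/val_inj.
Qed.

Lemma add_box_sumn : sumn sh' = (sumn sh).+1.
Proof.
have := add_box_sum (fun _ _ => 1); rewrite !sumr_const !card_ord.
by rewrite -mulrSr !natz => -[].
Qed.

Hypothesis corner : forall r', (c < nth 0 sh r')%N = (r' < r)%N.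

(** The new box shares its row with c boxes and, by [corner], its column with r boxes; each such
    pair counts in both orders, and the degree grows by 1. *)
Lemma add_box_content : content sh' = content sh + 1 + (c%:Z - r%:Z) *+ 2.
Proof.
pose H x y r' c' := hook (r', c') (x, y).
have hookC b b' : hook b b' = hook b' b by rewrite /hook (eq_sym b.1) (eq_sym b.2).
have new : \sum_(i < sumn sh) hook (reshape_index sh i, reshape_offset sh i) (r, c) = c%:Z - r%:Z.
  pose R := (r.+1 + size sh)%N.
  have rR : (r < R)%N by rewrite /R ltn_addr.
  rewrite (@boxes_sum _ R (H r c)); last by rewrite /R leq_addl.
  rewrite /H /hook /=.
  under eq_bigr do rewrite sumrB.
  rewrite sumrB; congr (_ - _).
    rewrite (bigD1 (Ordinal rR)) //= eqxx sumr_const card_ord big1 ?addr0 ?natz //.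
    move=> r' r'r; rewrite big1 // => c' _; rewrite (_ : (_ == r) = false) //.
    by apply: contraNF r'r => /eqP e; apply/eqP/val_inj.
  (* Row r' meets column c exactly when it is longer than c, that is when r' < r. *)
  transitivity (\sum_(r' < R) (r' < r)%:R : int).
    apply: eq_bigr => r' _; rewrite -corner; case: ltnP => lt_c.
      rewrite (bigD1 (Ordinal lt_c)) //= eqxx big1 ?addr0 // => c' c'c.
      rewrite (_ : (_ == c) = false) //.
      by apply: contraNF c'c => /eqP e; apply/eqP/val_inj.
    by rewrite big1 // => c' _; rewrite ltn_eqF // (leq_trans _ lt_c).
  transitivity (\sum_(r' < R | (r' < r)%N) 1 : int).
    by rewrite [RHS]big_mkcond; apply: eq_bigr => r' _; case: ltnP.
  by rewrite -(big_ord_widen R (fun=> 1)) ?(ltnW rR) // sumr_const card_ord natz.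
rewrite !contentE.
pose S1 x y := \sum_(i < sumn sh') hook (x, y) (reshape_index sh' i, reshape_offset sh' i).
rewrite (add_box_sum S1) /S1.
under eq_bigr do rewrite (add_box_sum (fun x y => hook _ (x, y))).
rewrite (add_box_sum (fun x y => hook _ (x, y))) big_split /= new.
under [X in _ + (_ + (X + _))]eq_bigr do rewrite hookC.
have -> : hook (r, c) (r, c) = 0 by rewrite /hook !eqxx subrr.
rewrite new add_box_sumn -natz mulrS natz /=; set A := \sum_(i < _) _.
by move: A (c%:Z - r%:Z) => A x; ring.
Qed.
End AddBox.

Section CasSimple.
Variables (F : numFieldType) (sh : seq nat).
Local Notation n := (sumn sh).
Local Notation e := (idem (simple_obj F sh)).
Local Notation D := (fam1_pfam n).
Local Notation pmor s := (@bmor F D D (bperm s)).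

Lemma group_eltE (x : 'S_n -> int) : group_elt F x = \sum_s (x s)%:~R *: pmor s.
Proof. by apply: eq_bigr => s _; rewrite mperm_bmor. Qed.

Lemma entry_group_elt (x : 'S_n -> int) s :
  @entry F D D (group_elt F x) (bperm s) = (x s)%:~R.
Proof.
rewrite group_eltE entry_sum (bigD1 s) //= big1 => [|t ts].
  by rewrite entryZ entry_bmor eqxx mulr1 addr0.
by rewrite entryZ entry_bmor (inj_eq (@bperm_inj _)) eq_sym (negPf ts) mulr0.
Qed.

(** Centrality makes the action scalar; comparing traces identifies the scalar, because the trace of
    (i j) e is the coefficient of e at (i j). *)
Lemma cas_simple : lcomp (cas F D) e = (content sh)%:~R *: e.
Proof.
have [s|c ce] := @simple_central F sh (cas F D); first exact: cas_natural.
rewrite ce; congr (_ *: _); apply: (mulIf (x := tr e)).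
  by rewrite tr_idem_simple invr_eq0 young_coef_neq0.
rewrite -trZ -ce /cas lcomp_suml /tr entry_sum /content rmorph_sum mulr_suml.
apply: eq_bigr => i _; rewrite lcomp_suml entry_sum rmorph_sum mulr_suml.
apply: eq_bigr => j _.
have := @tr_bmor F D D e (bperm (tperm i j)) (bperm (tperm i j)).
rewrite bcomp_perm tperm2 /tr => -> //.
by rewrite -/(tr _) tr_idem_simple idem_simpleE entryZ entry_group_elt mulrC.
Qed.

Lemma idem_neq0 : e != 0.
Proof.
apply/eqP => e0; have /eqP := tr_idem_simple F sh.
by rewrite e0 /tr /entry ffunE eq_sym invr_eq0 (negPf (young_coef_neq0 _ _)).
Qed.

Definition rowm := group_elt F (@rowsym sh).
Definition colm := group_elt F (@colsym sh).

Lemma idem_rowcol : e = (young_coef sh)%:~R^-1 *: lcomp rowm colm.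
Proof. by rewrite idem_simpleE lcomp.unlock group_elt_comp. Qed.

Lemma rowm_perm p : p \in rowstab sh -> lcomp rowm (pmor p) = rowm.
Proof.
move=> pP; rewrite /rowm group_eltE lcomp_suml (reindex_inj (mulgI p^-1%g)) /=.
apply: eq_bigr => s _; rewrite lcompZl bmor_perm mulKVg.
by rewrite /rowsym groupMl ?groupV.
Qed.

Lemma colm_perm q : q \in colstab sh -> lcomp (pmor q) colm = (-1) ^+ q *: colm.
Proof.
move=> qQ; rewrite /colm group_eltE lcomp_sumr (reindex_inj (mulIg q^-1%g)) /=.
rewrite scaler_sumr; apply: eq_bigr => s _.
rewrite lcompZr bmor_perm mulgKV scalerA; congr (_ *: _).
rewrite /colsym groupMr ?groupV // odd_permM odd_permV signr_addb.
by rewrite !rmorphM !rmorphXn !rmorphN1 mulrAC mulrA mulrC mulrA.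
Qed.

End CasSimple.

(** By naturality the total sum of transpositions acts through e_mu, hence by [content mu]; the one
    on the points of [la] acts through e_la. The difference is what involves [Y]. *)
Lemma in_hom_content (F : numFieldType) (la mu : seq nat) (Y : pfam)
    (w : mor F (fam1_pfam (sumn mu)) (famtens_pfam (fam1_pfam (sumn la)) Y)) :
  in_hom w ->
  (content mu - content la)%:~R *: w =
  lcomp (ltens (mid F (fam1_pfam (sumn la))) (cas F Y)) w
    + lcomp (\sum_i jm F (fam1_pfam (sumn la)) i) w *+ 2.
Proof.
move=> [Ew wmu].
have e1 : lcomp (cas F _) w = (content mu)%:~R *: w.
  by rewrite cas_natural -{1}wmu -lcompA -cas_natural cas_simple lcompZr wmu.
have e2 : lcomp (ltens (cas F (fam1_pfam (sumn la))) (mid F Y)) w = (content la)%:~R *: w.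
  by rewrite -{1}Ew lcompA ltens_comp mid_l cas_simple ltensZl lcompZl Ew.
rewrite rmorphB scalerBl -e1 -e2 cas_tens_comp -!addrA addrC -!addrA.
by rewrite addNr addr0.
Qed.

Lemma odd_ptens m n (s : 'S_m) : odd_perm (ptens s (1 : 'S_n)) = odd_perm s.
Proof.
have [ts -> dts] := prod_tpermP s.
elim: ts dts => [|t ts IH] /= => [_|/andP[dt dts]].
  by rewrite big_nil ptens1 !odd_perm1.
rewrite big_cons -[X in ptens _ X]mulg1 ptensM !odd_permM IH // ptens_tperm !odd_tperm.
by rewrite (inj_eq (@lshift_inj _ _)).
Qed.

Lemma odd_bconj m n (b : nbij m n) (s : 'S_m) (t : 'S_n) :
  bcomp b (bperm s) = bcomp (bperm t) b -> odd_perm t = odd_perm s.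
Proof.
have e : m = n by case: b => b /= /andP[/eqP].
case: n / e b t => b t; have [u ->] := bperm_surj b.
rewrite !bcomp_perm => /bperm_inj/(congr1 (@odd_perm _)).
by rewrite !odd_permM addbC => /addbI.
Qed.

(** * Hom spaces for one added box *)

Section OneBox.
Variables (F : numFieldType) (la nu : seq nat) (r : nat).
Hypothesis box : add_box la nu r.
Local Notation n := (sumn la).
Local Notation N := (fam1_pfam n).
Local Notation D := (fam1_pfam (sumn nu)).
Local Notation Y := (fam1_pfam 1).
Local Notation T := (famtens_pfam N Y).
Local Notation E := (ltens (idem (simple_obj F la)) (mid F Y)).

(** In reading order the new box shifts the numbers of later boxes, so boxes are matched by their
    row and column, and the extra point goes to the new box. *)
Lemma add_box_bij : exists b : nbij (n + 1) (sumn nu),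
  [/\ forall i, reshape_index nu (val b (lshift 1 i)) = reshape_index la i &
      forall i, reshape_offset nu (val b (lshift 1 i)) = reshape_offset la i].
Proof.
have cell (i : 'I_n) : exists j : 'I_(sumn nu),
    (reshape_index nu j == reshape_index la i) && (reshape_offset nu j == reshape_offset la i).
  have [|j [rj cj]] := @cellP nu (reshape_index la i) (reshape_offset la i).
    by rewrite box ltn_addl // col_lt.
  by exists j; rewrite rj cj !eqxx.
pose f i := xchoose (cell i).
have fr i : reshape_index nu (f i) = reshape_index la i.
  by have /andP[/eqP] := xchooseP (cell i).
have fc i : reshape_offset nu (f i) = reshape_offset la i.
  by have /andP[_ /eqP] := xchooseP (cell i).
have [|z [zr zc]] := @cellP nu r (nth 0%N la r); first by rewrite box eqxx.
have fz i : f i != z.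
  apply/eqP => fiz; have := col_lt i.
  by rewrite -fr -fc fiz zr zc ltnn.
pose g : {ffun 'I_(n + 1) -> 'I_(sumn nu)} :=
  [ffun i => match split i with inl j => f j | inr _ => z end].
have g_inj : nbij_pred g.
  apply/andP; split; first by rewrite (add_box_sumn box) addn1.
  apply/injectiveP => i j; rewrite !ffunE.
  case: (split_ordP i) => i' ->; case: (split_ordP j) => j' ->.
  - move=> e; congr lshift; apply: rowcol_inj; first by rewrite -!fr e.
    by rewrite -!fc e.
  - by move/eqP; rewrite (negPf (fz _)).
  - by move/eqP; rewrite eq_sym (negPf (fz _)).
  by rewrite !ord1.
exists (exist (@nbij_pred _ _) g g_inj); split => i /=; rewrite ffunE;
  by case: split_ordP => j /eqP; rewrite ?eq_lrshift // => /eqP/lshift_inj <-.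
Qed.

(* Identify the diagram of la with a part of that of nu, and write R, C and R', C'
   for the row and column sums of nu and la.  As R R' and C' C are multiples of R
   and C, R R' C' C R C is a multiple of R C R C, so R' C' C R C is not 0. *)
Lemma hom_box_neq0 : exists2 y : mor F D T, in_hom y & y != 0.
Proof.
have [b [br bc]] := add_box_bij; have [b' b'b bb'] := binvP b.
have [g gK Kg] := nbij_bij b.
have conj (s : 'S_n) : exists s' : 'S_(sumn nu),
    bcomp b (bperm (ptens s 1)) = bcomp (bperm s') b.
  have [s' s'E] := bperm_surj (bcomp (bcomp b (bperm (ptens s 1))) b').
  by exists s'; rewrite -s'E -bcompA b'b bcompb1.
have conjE s s' i : bcomp b (bperm (ptens s 1)) = bcomp (bperm s') b ->
    s' (val b i) = val b (ptens s 1 i).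
  by move/(congr1 val)/ffunP/(_ i); rewrite !ffunE.
have conj' s s' : bcomp b (bperm (ptens s 1)) = bcomp (bperm s') b ->
    bcomp (bperm (ptens s 1)) b' = bcomp b' (bperm s').
  move=> e; rewrite -[LHS]bcomp1b -b'b -!bcompA; congr bcomp.
  by rewrite bcompA e -bcompA bb' bcompb1.
have conjP p p' : bcomp b (bperm (ptens p 1)) = bcomp (bperm p') b ->
    p \in rowstab la -> p' \in rowstab nu.
  move=> e /rowstabP pP; apply/rowstabP => i; rewrite -(Kg i) (conjE _ _ _ e).
  case: (split_ordP (g i)) => j ->; first by rewrite ptensl !br.
  by rewrite ptensr perm1.
have conjQ p p' : bcomp b (bperm (ptens p 1)) = bcomp (bperm p') b ->
    p \in colstab la -> p' \in colstab nu.
  move=> e /colstabP pP; apply/colstabP => i; rewrite -(Kg i) (conjE _ _ _ e).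
  case: (split_ordP (g i)) => j ->; first by rewrite ptensl !bc.
  by rewrite ptensr perm1.
pose B := @bmor F T D b; pose B' := @bmor F D T b'.
have pext (s : 'S_n) : ltens (@bmor F N N (bperm s)) (mid F Y) =
    @bmor F T T (bperm (ptens s 1)) by rewrite bmor_tens -bperm_ptens.
have rowB : lcomp (lcomp (rowm F nu) B) (ltens (rowm F la) (mid F Y)) =
    #|rowstab la|%:R *: lcomp (rowm F nu) B.
  rewrite {2}/rowm group_eltE ltens_suml lcomp_sumr scaler_nat -sumr_const [RHS]big_mkcond.
  apply: eq_bigr => s _; rewrite ltensZl lcompZr pext /rowsym.
  case: ifP => sP; last by rewrite scale0r.
  have [s' s'E] := conj s.
  by rewrite scale1r -lcompA bmor_comp s'E -(@bmor_comp F T D D) lcompA rowm_perm // (conjP _ _ s'E).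
have colB : lcomp (ltens (colm F la) (mid F Y)) (lcomp B' (colm F nu)) =
    #|colstab la|%:R *: lcomp B' (colm F nu).
  rewrite {1}/colm group_eltE ltens_suml lcomp_suml scaler_nat -sumr_const [RHS]big_mkcond.
  apply: eq_bigr => s _; rewrite ltensZl lcompZl pext /colsym.
  case: ifP => sQ; last by rewrite mulr0 scale0r.
  have [s' s'E] := conj s.
  rewrite lcompA bmor_comp (conj' _ _ s'E) -(@bmor_comp F D D T) -lcompA colm_perm ?(conjQ _ _ s'E) //.
  rewrite lcompZr scalerA mulr1 -(odd_ptens 1 s) -(odd_bconj s'E).
  by rewrite rmorphXn rmorphN1 -signr_addb addbb scale1r.
pose y := lcomp E (lcomp (lcomp B' (colm F nu)) (idem (simple_obj F nu))).
exists y.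
  split; first by rewrite /y lcompA ltens_comp simple_idem mid_l.
  by rewrite /y -!lcompA simple_idem.
apply/eqP => y0.
have E_rowcol : E = (young_coef la)%:~R^-1 *:
    lcomp (ltens (rowm F la) (mid F Y)) (ltens (colm F la) (mid F Y)).
  by rewrite ltens_comp mid_l -ltensZl -idem_rowcol.
have BB' : lcomp B B' = mid F D by rewrite bmor_comp bb'.
(* Up to a nonzero scalar, [lcomp (rowm F nu) B] is a left inverse of [y]. *)
have : lcomp (lcomp (rowm F nu) B) y =
    ((young_coef la)%:~R^-1 * (#|rowstab la|%:R * (#|colstab la|%:R * (young_coef nu)%:~R))) *:
      idem (simple_obj F nu).
  rewrite /y E_rowcol lcompZl lcompZr -!scalerA; congr (_ *: _).
  pose R := lcomp (rowm F nu) B; pose C := lcomp B' (colm F nu).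
  rewrite -/R -/C lcompA (lcompA R) [X in lcomp (lcomp X _)]rowB -/R.
  rewrite lcompZl lcompZl; congr (_ *: _).
  rewrite -(lcompA R) (lcompA (ltens (colm F la) _)) colB -/C.
  rewrite lcompZl lcompZr; congr (_ *: _).
  have RC : lcomp R C = (young_coef nu)%:~R *: idem (simple_obj F nu).
    rewrite /R /C -lcompA (lcompA B) BB' mid_l idem_rowcol scalerA.
    by rewrite mulfV ?young_coef_neq0 // scale1r.
  by rewrite lcompA RC lcompZl simple_idem.
rewrite y0 linear0 => /esym/eqP; rewrite scaler_eq0 !mulf_eq0 invr_eq0 !pnatr_eq0.
rewrite !(negPf (young_coef_neq0 _ _)) (negPf (idem_neq0 _ _)).
have card_neq0 (G : {group 'S_n}) : (#|G| == 0%N) = false by apply/negbTE; rewrite -lt0n cardG_gt0.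
by rewrite (card_neq0 (rowstab_group la)) (card_neq0 (colstab_group la)).
Qed.

Lemma jm_eigen (y : mor F D T) (i : 'I_1) : in_hom y ->
  (forall r', (nth 0 la r < nth 0 la r')%N = (r' < r)%N) ->
  lcomp (jm F N (i : 'I_(dg Y))) y = ((nth 0%N la r)%:R - r%:R) *: y.
Proof.
move=> hy corner; have := in_hom_content hy.
have -> : cas F Y = mid F Y by rewrite /cas big_ord1 big_ord1 tperm1.
rewrite mid_tens mid_l [\sum_i _]big_ord1 !ord1.
have -> : content nu - content la = 1 + ((nth 0 la r)%:Z - r%:Z) *+ 2.
  by rewrite (add_box_content box corner); ring.
rewrite rmorphD rmorph1 scalerDl scale1r => /addrI e.
apply: (scalerI (a := 2%:R)); first by rewrite pnatr_eq0.
by rewrite scaler_nat -e scalerA mulr_natl rmorphMn rmorphB.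
Qed.

Lemma hom_box_dim (y y' : mor F D T) : 
  (forall r', (nth 0 la r < nth 0 la r')%N = (r' < r)%N) ->
  in_hom y -> y != 0 -> in_hom y' -> exists c, y' = c *: y.
Proof.
move=> corner hy y0 hy'.
pose V (w : mor F D T) := exists c, w = c *: y.
have hom_scale c : in_hom (c *: y).
  have [h1 h2] := hy; split; first by rewrite lcompZr h1.
  by rewrite lcompZl h2.
apply: (@hom_irreducible F la nu Y V _ _ _ _ _ y) => //.
- by exists 0; rewrite scale0r.
- by move=> c _ _ [a ->] [b ->]; exists (c * a + b); rewrite scalerDl scalerA.
- by move=> _ [c ->].
- move=> t _ [c ->]; exists c.
  have -> : t = 1%g by apply/permP => i; rewrite !ord1.
  by rewrite mid_tens mid_l.
- move=> i _ [c ->]; exists (c * ((nth 0%N la r)%:R - r%:R)).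
  by rewrite lcompZr -/(jm F N (i : 'I_(dg Y))) jm_eigen // scalerA.
by exists 1; rewrite scale1r.
Qed.

End OneBox.

(** * Linear algebra of the seminormal form *)

Section Seminormal.
Variables (F : numFieldType) (W : lmodType F) (G J : {linear W -> W}).
Variables (H : W -> Prop) (a b : F) (v v' : W).
Hypothesis GK : forall w, G (G w) = w.
Hypothesis HG : forall w, H w -> H (G w).
Hypothesis rel : forall w, H w -> J w + G (J (G w)) + G w = (a + b) *: w.
Hypotheses (Hv : H v) (Hv' : H v') (v0 : v != 0) (v'0 : v' != 0).
Hypotheses (Jv : J v = a *: v) (Jv' : J v' = b *: v') (ab : a != b).
Hypothesis span : forall h, H h -> exists x y, h = x *: v + y *: G v.
Local Notation k := (a - b).

Let k0 : k != 0. Proof. by rewrite subr_eq0. Qed.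

Let lc x y := x *: v + y *: v'.

Let lcZ c x y : c *: lc x y = lc (c * x) (c * y).
Proof. by rewrite /lc scalerDr !scalerA. Qed.

Let lcD x y x' y' : lc x y + lc x' y' = lc (x + x') (y + y').
Proof. by rewrite /lc addrACA -!scalerDl. Qed.

Let lcN x y : - lc x y = lc (- x) (- y).
Proof. by rewrite /lc opprD !scaleNr. Qed.

Let lcl : v = lc 1 0. Proof. by rewrite /lc scale1r scale0r addr0. Qed.

Let lcr : v' = lc 0 1. Proof. by rewrite /lc scale1r scale0r add0r. Qed.

Let lcJ x y : J (lc x y) = lc (x * a) (y * b).
Proof. by rewrite /lc [LHS]linearD; congr (_ + _); rewrite [LHS]linearZ /= ?Jv ?Jv' scalerA. Qed.

Let lcG p q r t x y : G v = lc p q -> G v' = lc r t ->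
  G (lc x y) = lc (x * p + y * r) (x * q + y * t).
Proof.
move=> Gv Gv'; rewrite -lcD -!lcZ -Gv -Gv' /lc [LHS]linearD.
by congr (_ + _); rewrite [LHS]linearZ.
Qed.

Lemma eigen_indep x y : x *: v + y *: v' = 0 -> x = 0 /\ y = 0.
Proof.
move=> e; have : J (lc x y) - b *: lc x y = 0 by rewrite /lc e linear0 scaler0 subr0.
rewrite lcJ lcZ lcN lcD [y * b]mulrC subrr [x * a]mulrC -mulrBl /lc scale0r addr0.
move=> /eqP; rewrite scaler_eq0 (negPf v0) orbF mulf_eq0 (negPf k0) /= => /eqP x0.
split=> //; move: e; rewrite x0 scale0r add0r => /eqP.
by rewrite scaler_eq0 (negPf v'0) orbF => /eqP.
Qed.

Lemma eigen_inj x y x' y' :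
  x *: v + y *: v' = x' *: v + y' *: v' -> x = x' /\ y = y'.
Proof.
rewrite -/(lc x y) -/(lc x' y') => e; have [|/eqP + /eqP] := @eigen_indep (x - x') (y - y').
  by rewrite -[LHS]/(lc _ _) -lcD -lcN e subrr.
by rewrite !subr_eq0 => /eqP-> /eqP->.
Qed.

Lemma eigen_span h : H h -> exists x y, h = x *: v + y *: v'.
Proof.
have [p [q v'E]] := span Hv'.
(* Otherwise v' would be a multiple of v, hence an eigenvector of J for both a and b. *)
have q0 : q != 0.
  apply: contraNneq v'0 => q0; move: v'E; rewrite q0 scale0r addr0 => v'E.
  have := Jv'; rewrite v'E [LHS]linearZ /= Jv !scalerA => /eqP.
  rewrite -subr_eq0 -scalerBl scaler_eq0 (negPf v0) orbF mulrC -mulrBl mulf_eq0.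
  by rewrite (negPf k0) /= => /eqP ->; rewrite scale0r.
have GvE : G v = lc (- (q^-1 * p)) q^-1.
  by rewrite /lc v'E scalerDr !scalerA mulVf // scale1r scaleNr addKr.
move=> /span[x [y ->]]; rewrite GvE lcZ {1}lcl lcZ lcD.
by do 2!eexists.
Qed.

Lemma eigen_involution : exists q r, [/\ G v = - k^-1 *: v + q *: v',
  G v' = r *: v + k^-1 *: v' & q * r = 1 - k^-2].
Proof.
have [p [q Gv]] := eigen_span (HG Hv); have [r [t Gv']] := eigen_span (HG Hv').
have G2 x y := lcG x y Gv Gv'.
(* This is [rel] at [G w]. At v, its v-coordinate reads 2 a p + 1 = (a + b) p, so p = -1/k; at v',
   its v'-coordinate gives t = 1/k in the same way. *)
have rel' w : H w -> G (J w) + J (G w) + w = (a + b) *: G w.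
  by move=> Hw; rewrite -[RHS]linearZ /= -rel // !linearD /= !GK.
have pE : p = - k^-1.
  have := rel' _ Hv; rewrite Jv lcl lcZ !G2 lcJ !lcD lcZ => /eigen_inj[e _].
  by apply: (mulIf k0); rewrite mulNr mulVf // -[LHS](addrK ((a + b) * (1 * p + 0 * r))) -{2}e; ring.
have tE : t = k^-1.
  have := rel' _ Hv'; rewrite Jv' lcr lcZ !G2 lcJ !lcD lcZ => /eigen_inj[_ e].
  by apply: (mulIf k0); rewrite mulVf // -[LHS](addrK ((a + b) * (0 * q + 1 * t))) -{1}e; ring.
exists q, r; split; rewrite -?pE -?tE //.
(* The v-coordinate of G (G v) = v is p^2 + q r = 1. *)
have := GK v; rewrite lcl !G2 => /eigen_inj[e _].
have -> : q * r = 1 - p * p by rewrite -e; ring.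
by rewrite pE; field.
Qed.

Hypotheses (Gv : G v = - k^-1 *: v + (1 - k^-2) *: v') (Gv' : G v' = v + k^-1 *: v').

Let G2 x y : G (lc x y) = lc (x * - k^-1 + y) (x * (1 - k^-2) + y * k^-1).
Proof. by rewrite (lcG x y Gv (r := 1) (t := k^-1)) ?mulr1 // /lc scale1r. Qed.

Let lc1 x : x *: v + v' = lc x 1. Proof. by rewrite /lc scale1r. Qed.

Lemma seminormal_plus : k + 1 != 0 -> G ((k / (k + 1)) *: v + v') = (k / (k + 1)) *: v + v'.
Proof. by move=> k1; rewrite !lc1 G2; congr lc; field; rewrite ?k1 ?k0. Qed.

Lemma seminormal_minus : k - 1 != 0 ->
  G ((- k / (k - 1)) *: v + v') = - ((- k / (k - 1)) *: v + v').
Proof. by move=> k1; rewrite !lc1 G2 lcN; congr lc; field; rewrite ?k1 ?k0. Qed.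

(** The v-coordinate of G h = h already fixes the ratio of the two coordinates of h. *)
Lemma seminormal_plus_uniq h : k + 1 != 0 -> H h -> G h = h ->
  exists c, h = c *: ((k / (k + 1)) *: v + v').
Proof.
move=> k1 /eigen_span[x [y ->]]; rewrite -/(lc x y) G2 lc1 => /eigen_inj[e _]; exists y.
have -> : y = x * (k + 1) / k by rewrite -[y](addKr (x * - k^-1)) e; field.
by rewrite lcZ; congr lc; field; rewrite ?k1 ?k0.
Qed.

Lemma seminormal_minus_uniq h : k - 1 != 0 -> H h -> G h = - h ->
  exists c, h = c *: ((- k / (k - 1)) *: v + v').
Proof.
move=> k1 /eigen_span[x [y ->]]; rewrite -/(lc x y) G2 lc1 lcN => /eigen_inj[e _]; exists y.
have -> : y = - x * (k - 1) / k by rewrite -[y](addKr (x * - k^-1)) e; field.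
by rewrite lcZ; congr lc; field; rewrite ?k1 ?k0.
Qed.

End Seminormal.

(** * Two added points: associator and swap *)

Notation boxf := (fam1_pfam 1).
Notation boxf2 := (famtens_pfam boxf boxf).

Lemma perm2P (t : 'S_(1 + 1)) : t = 1%g \/ t = tperm (lshift 1 ord0) (rshift 1 ord0).
Proof.
set p := lshift 1 ord0; set q := rshift 1 ord0.
have pq : p != q by rewrite eq_lrshift.
have two i : i = p \/ i = q.
  by case: (split_ordP i) => j ->; rewrite [j]ord1; [left|right].
have tpq : t p != t q by rewrite (inj_eq perm_inj).
have [tp|tp] := two (t p); have [tq|tq] := two (t q); rewrite ?tp ?tq ?eqxx // in tpq.
  by left; apply/permP => i; rewrite perm1; case: (two i) => ->.
by right; apply/permP => i; case: (two i) => ->; rewrite ?tpermL ?tpermR.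
Qed.

Section Associator.
Variables (F : numFieldType) (n : nat).
Local Notation N := (fam1_pfam n).
Local Notation T := (famtens_pfam N boxf2).
Local Notation T' := (famtens_pfam (famtens_pfam N boxf) boxf).

Definition assoc_bmor : mor F T' T := @bmor F T' T (bcast (esym (addnA n 1 1))).
Definition assoc_inv : mor F T T' := @bmor F T T' (bcast (addnA n 1 1)).

Lemma massocE : massoc F N boxf boxf = assoc_bmor.
Proof.
rewrite /massoc (big_pred1 tt) => [|[]//]; rewrite (big_pred1 tt) => [|[]//].
by rewrite (big_pred1 tt) => [|[]//]; rewrite /assoc_bmor bmor.unlock.
Qed.

Lemma bcast_comp m p (e : m = p) (e' : p = m) : bcomp (bcast e) (bcast e') = bperm 1.
Proof. by apply/nbijP => i; rewrite !ffunE perm1; apply: val_inj. Qed.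

Lemma assoc_bmorK : lcomp assoc_inv assoc_bmor = mid F T'.
Proof. by rewrite bmor_comp bcast_comp. Qed.

Lemma assoc_bmor_tens (f : mor F N N) :
  lcomp assoc_bmor (ltens (ltens f (mid F boxf)) (mid F boxf)) = lcomp (ltens f (mid F boxf2)) assoc_bmor.
Proof.
rewrite [f]mor_bmor !ltens_suml lcomp_suml lcomp_sumr; apply: eq_bigr => b _.
rewrite !ltensZl lcompZl lcompZr; congr (_ *: _).
rewrite !bmor_tens !bmor_comp; congr (@bmor F T' T _); apply/nbijP => i; rewrite !ffunE.
have [{}i ->] : exists j, i = cast_ord (addnA n 1 1) j.
  by exists (cast_ord (esym (addnA n 1 1)) i); apply: val_inj.
apply: val_inj; rewrite cast_ordK.
case: (split_ordP i) => j -> /=.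
  have -> : cast_ord (addnA n 1 1) (lshift (1 + 1) j) = lshift 1 (lshift 1 j) by apply: val_inj.
  case: split_ordP => j' /eqP; last by rewrite eq_lrshift.
  move=> /eqP/lshift_inj <-; rewrite ffunE.
  by case: split_ordP => j'' /eqP; rewrite ?eq_lrshift // => /eqP/lshift_inj <-.
rewrite ffunE perm1 /=.
case: (split_ordP j) => l ->.
  have -> : cast_ord (addnA n 1 1) (rshift n (lshift 1 l)) = lshift 1 (rshift n l) by apply: val_inj.
  case: split_ordP => j' /eqP; last by rewrite eq_lrshift.
  move=> /eqP/lshift_inj <-; rewrite ffunE.
  case: split_ordP => j'' /eqP; rewrite ?eq_rlshift // => /eqP/rshift_inj <-.
  by rewrite ffunE perm1.
have -> : cast_ord (addnA n 1 1) (rshift n (rshift 1 l)) = rshift (n + 1) l.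
  by apply: val_inj => /=; rewrite addnA.
case: split_ordP => j' /eqP; first by rewrite eq_rlshift.
by move=> /eqP/rshift_inj <-; rewrite ffunE perm1 /= addnA.
Qed.

Lemma assoc_bmor_jm :
  lcomp assoc_bmor (ltens (jm F N (ord0 : 'I_(dg boxf))) (mid F boxf)) =
  lcomp (jm F N (lshift 1 ord0 : 'I_(dg boxf2))) assoc_bmor.
Proof.
rewrite /jm ltens_suml lcomp_sumr lcomp_suml; apply: eq_bigr => a _.
rewrite bmor_tens btens_tperm !bmor_comp bcomp_tperm.
congr (@bmor F T' T (bcomp (bperm (tperm _ _)) _)); rewrite ffunE; exact: val_inj.
Qed.

Definition swap : mor F T T :=
  @bmor F T T (bperm (tperm (rshift n (lshift 1 ord0)) (rshift n (rshift 1 ord0)))).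

Lemma swapK : lcomp swap swap = mid F T.
Proof. by rewrite bmor_perm tperm2. Qed.

Lemma swap_tens : swap =
  ltens (mid F N) (@bmor F boxf2 boxf2 (bperm (tperm (lshift 1 ord0) (rshift 1 ord0)))).
Proof. by rewrite bmor_tens btens_tpermr. Qed.

(** Conjugation by the swap exchanges the two added points. The sum on the right ranges over the
    points of [N] only; the classical second Jucys-Murphy element also contains the swap. *)
Lemma swap_jm :
  lcomp swap (lcomp (jm F N (lshift 1 ord0 : 'I_(dg boxf2))) swap) =
  jm F N (rshift 1 ord0 : 'I_(dg boxf2)).
Proof.
rewrite /jm lcomp_suml lcomp_sumr; apply: eq_bigr => a _.
rewrite bmor_perm bmor_perm; congr (@bmor F T T (bperm _)).
set t := tperm (rshift n _) _.
have -> : (t * tperm (lshift _ a) (rshift n (lshift 1 ord0)) * t =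
    tperm (lshift _ a) (rshift n (lshift 1 ord0)) ^ t)%g by rewrite conjgE tpermV mulgA.
by rewrite tpermJ tpermL tpermD // eq_rlshift.
Qed.

Lemma cas_boxf2 : cas F boxf2 = mid F boxf2 *+ 2 +
   (@bmor F boxf2 boxf2 (bperm (tperm (lshift 1 ord0) (rshift 1 ord0)))) *+ 2.
Proof.
rewrite /cas big_split_ord !big_ord1 !big_split_ord !big_ord1 /= !tperm1.
by rewrite [tperm (rshift 1 _) _]tpermC !mulr2n -/(mid F boxf2) -!addrA; congr (_ + _); rewrite addrA addrC.
Qed.

End Associator.

(** * Left trees *)

Section TwoBoxes.
Variables (F : numFieldType) (la nu mu : seq nat) (r1 r2 : nat).
Hypotheses (box1 : add_box la nu r1) (box2 : add_box nu mu r2).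
Hypothesis corner1 : forall r', (nth 0 la r1 < nth 0 la r')%N = (r' < r1)%N.
Hypothesis corner2 : forall r', (nth 0 nu r2 < nth 0 nu r')%N = (r' < r2)%N.
Local Notation n := (sumn la).
Local Notation N := (fam1_pfam n).
Local Notation D := (fam1_pfam (sumn mu)).
Local Notation T := (famtens_pfam N boxf2).
Local Notation E := (ltens (idem (simple_obj F la)) (mid F boxf2)).
Local Notation hom := (@in_hom F la mu boxf2).
Local Notation J1 := (jm F N (lshift 1 ord0 : 'I_(dg boxf2))).
Local Notation J2 := (jm F N (rshift 1 ord0 : 'I_(dg boxf2))).
Local Notation a := ((nth 0%N la r1)%:R - r1%:R : F).
Local Notation b := ((nth 0%N nu r2)%:R - r2%:R : F).

Lemma hom_swap w : hom w -> hom (lcomp (swap F n) w).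
Proof.
move=> [Ew wmu]; split; last by rewrite -lcompA wmu.
have comm : lcomp E (swap F n) = lcomp (swap F n) E.
  by rewrite swap_tens !ltens_comp !mid_l !mid_r.
by rewrite lcompA comm -lcompA Ew.
Qed.

Lemma hom_lin c u v : hom u -> hom v -> hom (c *: u + v).
Proof.
move=> [Eu umu] [Ev vmu]; split; first by rewrite lcompDr lcompZr Eu Ev.
by rewrite lcompDl lcompZl umu vmu.
Qed.

(* The second Jucys-Murphy element is g J g + g, and the sum of the two is central. *)
Lemma swap_jm_rel w : hom w ->
  lcomp J1 w + lcomp (swap F n) (lcomp J1 (lcomp (swap F n) w)) + lcomp (swap F n) w
    = (a + b) *: w.
Proof.
move=> hw; have := in_hom_content hw.
have -> : lcomp (\sum_i jm F N (i : 'I_(dg boxf2))) w = lcomp J1 w + lcomp J2 w.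
  by rewrite big_split_ord !big_ord1; apply: lcompDl.
have -> : lcomp (ltens (mid F N) (cas F boxf2)) w = w *+ 2 + lcomp (swap F n) w *+ 2.
  rewrite (_ : ltens _ _ = mid F T *+ 2 + swap F n *+ 2).
    apply: etrans (lcompDl _ _ _) _; rewrite !mulr2n.
    by congr (_ + _); apply: etrans (lcompDl _ _ _) _; rewrite ?mid_l.
  rewrite cas_boxf2; apply: etrans (raddfD (@ltens F N N boxf2 boxf2 (mid F N)) _ _) _.
  by congr (_ + _); rewrite [LHS]raddfMn /= -?swap_tens ?mid_tens.
have -> : content mu - content la = 2 + ((nth 0 la r1)%:Z - r1%:Z + ((nth 0 nu r2)%:Z - r2%:Z)) *+ 2.
  by rewrite (add_box_content box2 corner2) (add_box_content box1 corner1); ring.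
rewrite -swap_jm -!lcompA => e; apply: (scalerI (a := 2%:R)); first by rewrite pnatr_eq0.
rewrite !scaler_nat; apply: (addrI (w *+ 2)).
transitivity (w *+ 2 + lcomp (swap F n) w *+ 2 +
    (lcomp J1 w + lcomp (swap F n) (lcomp J1 (lcomp (swap F n) w))) *+ 2).
  by rewrite mulrnDl [LHS]addrA [LHS]addrAC.
rewrite -e rmorphD scalerDl; congr (_ + _); first by rewrite -scaler_nat.
by rewrite rmorphMn rmorphD !rmorphB scalerMnl.
Qed.

Lemma tree_span v : hom v -> v != 0 -> lcomp J1 v = a *: v ->
  forall h, hom h -> exists x y, h = x *: v + y *: lcomp (swap F n) v.
Proof.
move=> hv v0 Jv h hh; set g := lcomp (swap F n) v.
pose V (w : mor F D T) := exists x y, w = x *: v + y *: g.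
have Gv c : c *: v = c *: v + 0 *: g by rewrite scale0r addr0.
have gg : lcomp (swap F n) g = v by rewrite /g lcompA swapK mid_l.
(* Apply the swap to [swap_jm_rel] at [v] and cancel a g. *)
have Jg : lcomp J1 g = b *: g - v.
  have := swap_jm_rel hv; rewrite Jv -/g => /(congr1 (lcomp (swap F n))).
  rewrite !lcompDr !lcompZr gg lcompA swapK mid_l -/g [(a + b) *: g]scalerDl -addrA => /addrI <-.
  by rewrite addrK.
have VG w : V w -> V (lcomp (swap F n) w).
  by move=> [x [y ->]]; exists y, x; rewrite lcompDr !lcompZr gg addrC.
have VJ w : V w -> V (lcomp J1 w).
  move=> [x [y ->]]; exists (x * a - y), (y * b).
  by rewrite lcompDr !lcompZr Jv Jg scalerBr !scalerA scalerBl -!addrA [_ - y *: v]addrC.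
apply: (@hom_irreducible F la mu boxf2 V _ _ _ _ _ v) => //.
- by exists 0, 0; rewrite !scale0r addr0.
- move=> c _ _ [x [y ->]] [x' [y' ->]]; exists (c * x + x'), (c * y + y').
  by rewrite scalerDr !scalerA addrACA -!scalerDl.
- move=> _ [x [y ->]]; rewrite -[y *: g]addr0.
  have h0 : hom 0 by have := hom_lin (-1) hv hv; rewrite scaleN1r addNr.
  by do 2!apply: hom_lin => //; apply: hom_swap.
- move=> t w Vw; have [->|->] := perm2P t.
  + by rewrite mid_tens mid_l.
  by rewrite -swap_tens; apply: VG.
- move=> i w Vw; rewrite -/(jm F N (i : 'I_(dg boxf2))).
  case: (split_ordP i) => j ->; rewrite [j]ord1; first exact: VJ.
  by rewrite -swap_jm -!lcompA; apply/VG/VJ/VG.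
by exists 1, 0; rewrite scale1r scale0r addr0.
Qed.

Section Tree.
Variables (y : mor F (fam1_pfam (sumn nu)) (famtens_pfam N boxf))
  (x : mor F D (famtens_pfam (fam1_pfam (sumn nu)) boxf)).
Hypotheses (hy : in_hom y) (hx : in_hom x) (y0 : y != 0) (x0 : x != 0).

Definition tree := lcomp (assoc_bmor F n) (lcomp (ltens y (mid F boxf)) x).

Lemma tree_hom : hom tree.
Proof.
have [Ey ynu] := hy; have [Ex xmu] := hx.
split; last by rewrite /tree -!lcompA xmu.
rewrite /tree lcompA -assoc_bmor_tens -lcompA; congr lcomp.
by rewrite lcompA ltens_comp Ey mid_l.
Qed.

(** The first Jucys-Murphy sum moves only the points of [N] and the first box, so it acts on the
    factor [y], where [jm_eigen] applies. *)
Lemma tree_jm : lcomp J1 tree = a *: tree.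
Proof.
rewrite /tree lcompA -assoc_bmor_jm -lcompA -lcompZr; congr lcomp.
by rewrite lcompA ltens_comp (jm_eigen box1) // ltensZl lcompZl mid_l.
Qed.

(** [simple_split] gives a [z] with z y = e_nu and the associator is invertible, so [x] can be
    recovered from the tree. *)
Lemma tree_neq0 : tree != 0.
Proof.
have [Ey ynu] := hy; have [Ex xmu] := hx; have [z zy] := simple_split ynu y0.
apply: contraNneq x0 => tree0; apply/eqP.
have : lcomp (ltens z (mid F boxf)) (lcomp (assoc_inv F n) tree) = 0 by rewrite tree0 !linear0.
by rewrite /tree !lcompA -(lcompA _ (assoc_inv F n)) assoc_bmorK mid_r ltens_comp zy mid_l Ex.
Qed.
End Tree.
End TwoBoxes.

(** * Endomorphisms of two boxes and right trees *)

Section Two.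
Variable F : numFieldType.

Definition flip : mor F boxf2 boxf2 :=
  @bmor F boxf2 boxf2 (bperm (tperm (lshift 1 ord0) (rshift 1 ord0))).

Lemma end_boxf2 (f : mor F boxf2 boxf2) : exists A B, f = A *: mid F boxf2 + B *: flip.
Proof.
rewrite [f]mor_bmor; apply: (big_ind (fun f => exists A B, f = A *: mid F boxf2 + B *: flip)).
- by exists 0, 0; rewrite !scale0r addr0.
- move=> _ _ [A [B ->]] [A' [B' ->]]; exists (A + A'), (B + B').
  by rewrite addrACA -!scalerDl.
move=> b _; move: (entry f b) => c.
have [t ->] := bperm_surj b; have [->|->] := perm2P t.
  by exists c, 0; rewrite scale0r addr0.
by exists 0, c; rewrite scale0r add0r.
Qed.

Lemma simple1_idem : idem (box F) = mid F boxf.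
Proof.
apply: (@pmorP F boxf boxf) => b; rewrite idem_simpleE entryZ.
have [s ->] := bperm_surj b; have -> : s = 1%g by apply/permP => i; rewrite !ord1.
rewrite entry_bmor eqxx (_ : entry _ _ = 1); last first.
  by apply: etrans (@entry_group_elt F [:: 1%N] _ 1%g) _; rewrite yform1.
have -> : young_coef [:: 1%N] = 1.
  rewrite /young_coef /conv (big_pred1 1%g) => [|t]; first by rewrite invg1 mulg1 yform1.
  by apply/esym/eqP/permP => i; rewrite !ord1.
by rewrite invr1 mulr1.
Qed.

End Two.

Section RightTree.
Variables (F : numFieldType) (la mu sh : seq nat) (eps : F).
Hypotheses (sh2 : sumn sh = (1 + 1)%N) (content_sh : (content sh)%:~R = 2%:R + 2%:R * eps).
Local Notation n := (sumn la).
Local Notation N := (fam1_pfam n).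
Local Notation D := (fam1_pfam (sumn mu)).
Local Notation B := (fam1_pfam (sumn sh)).
Local Notation T := (famtens_pfam N boxf2).
Local Notation E := (ltens (idem (simple_obj F la)) (mid F boxf2)).
Local Notation e := (idem (simple_obj F sh)).
Local Notation hom := (@in_hom F la mu boxf2).

Let iota : mor F B boxf2 := @bmor F B boxf2 (bcast sh2).
Let iotai : mor F boxf2 B := @bmor F boxf2 B (bcast (esym sh2)).

Let iotaK : lcomp iotai iota = mid F B. Proof. by rewrite bmor_comp bcast_comp. Qed.
Let iotaiK : lcomp iota iotai = mid F boxf2. Proof. by rewrite bmor_comp bcast_comp. Qed.

(** On two points the sum over ordered pairs is 2 + 2 flip, and it acts on the simple object by its
    content 2 + 2 eps. *)
Let flip_iota : lcomp (flip F) (lcomp iota e) = eps *: lcomp iota e.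
Proof.
set z := lcomp iota e.
have : lcomp (lcomp (cas F boxf2) iota) e = lcomp (lcomp iota (cas F B)) e by rewrite cas_natural.
rewrite -!lcompA cas_simple [X in _ = X]lcompZr -/z content_sh.
have -> : lcomp (cas F boxf2) z = z *+ 2 + lcomp (flip F) z *+ 2.
  rewrite cas_boxf2; apply: etrans (lcompDl _ _ _) _; rewrite !mulr2n.
  by congr (_ + _); apply: etrans (lcompDl _ _ _) _; rewrite ?mid_l.
rewrite scalerDl scaler_nat => /addrI; rewrite -scaler_nat -scalerA => /scalerI -> //.
by rewrite pnatr_eq0.
Qed.

(** Every endomorphism of two points is a combination of the identity and the flip, both scalar on
    [lcomp iota e]; hence these morphisms form a line. *)
Let right_scale (z : mor F B boxf2) : lcomp z e = z -> exists c, z = c *: lcomp iota e.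
Proof.
move=> ze; have [x [y f]] := end_boxf2 (lcomp z iotai).
exists (x + y * eps); rewrite -{1}ze -[z]mid_r -iotaK lcompA -lcompA f.
rewrite lcompDl !lcompZl flip_iota mid_l scalerA -scalerDl.
by [].
Qed.

Lemma right_eigen (z : mor F B boxf2) : lcomp z e = z -> lcomp (flip F) z = eps *: z.
Proof.
by move=> /right_scale[c ->]; rewrite lcompZr flip_iota !scalerA mulrC.
Qed.

Section Forward.
Variables (z : mor F B boxf2) (x : mor F D (famtens_pfam N B)).
Hypotheses (ze : lcomp z e = z) (z0 : z != 0) (x0 : x != 0).
Hypotheses (ex : lcomp (ltens (idem (simple_obj F la)) e) x = x).
Hypothesis xmu : lcomp x (idem (simple_obj F mu)) = x.

Definition rtree : mor F D T := lcomp (ltens (idem (simple_obj F la)) z) x.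

Lemma rtree_hom : hom rtree.
Proof.
split; last by rewrite /rtree -lcompA xmu.
by rewrite /rtree lcompA ltens_comp simple_idem mid_l.
Qed.

Lemma rtree_swap : lcomp (swap F n) rtree = eps *: rtree.
Proof.
by rewrite /rtree swap_tens lcompA ltens_comp mid_l -/(flip F) right_eigen // ltensZr lcompZl.
Qed.

Lemma rtree_neq0 : rtree != 0.
Proof.
have [c zE] := right_scale ze.
have c0 : c != 0 by apply: contraNneq z0 => c0; rewrite zE c0 scale0r.
apply: contraNneq x0 => w0; apply/eqP/(scalerI c0); rewrite scaler0.
have : lcomp (ltens (mid F N) iotai) rtree = 0 by rewrite w0 linear0.
rewrite /rtree lcompA ltens_comp mid_l zE lcompZr lcompA iotaK mid_l.
by rewrite ltensZr lcompZl ex.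
Qed.
End Forward.

(** The copy [f] of the idempotent e on two boxes is the projector onto the eps-eigenspace of the
    flip, so it fixes [h] and splits it through the simple object. *)
Lemma rtree_exists h : hom h -> h != 0 -> lcomp (swap F n) h = eps *: h ->
  exists (z : mor F B boxf2) (x : mor F D (famtens_pfam N B)),
  [/\ lcomp z e = z, z != 0, lcomp (ltens (idem (simple_obj F la)) e) x = x,
      lcomp x (idem (simple_obj F mu)) = x /\ x != 0 & h = rtree z x].
Proof.
move=> [Eh hmu] h0 gh; pose z := lcomp iota e.
have ze : lcomp z e = z by rewrite /z -lcompA simple_idem.
have z0 : z != 0.
  apply: contraNneq (idem_neq0 F sh) => z0; apply/eqP.
  by rewrite -[LHS]mid_l -iotaK -lcompA -/z z0 linear0.
pose f := lcomp z iotai; have [x [y fE]] := end_boxf2 f.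
(* [f] fixes [z], on which the flip acts by eps; hence it fixes every eps-eigenvector. *)
have xy : x + y * eps = 1.
  have zz : (x + y * eps) *: z = z.
    rewrite scalerDl -scalerA -flip_iota -/z -{1}[z]mid_l -!lcompZl -lcompDl -fE /f -lcompA.
    by rewrite [lcomp iotai z]lcompA iotaK mid_l.
  have /eqP : (x + y * eps - 1) *: z = 0 by rewrite scalerBl zz scale1r subrr.
  by rewrite scaler_eq0 (negPf z0) orbF subr_eq0 => /eqP.
have fh : lcomp (ltens (mid F N) f) h = h.
  rewrite fE.
  transitivity (x *: lcomp (ltens (mid F N) (mid F boxf2)) h + y *: lcomp (ltens (mid F N) (flip F)) h).
    rewrite -!lcompZl -!ltensZr; apply: etrans (lcompDl _ _ _).
    by congr lcomp; apply: (raddfD (@ltens F N N boxf2 boxf2 (mid F N))).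
  by rewrite mid_tens mid_l -swap_tens gh scalerA -scalerDl xy scale1r.
exists z, (lcomp (ltens (mid F N) iotai) h); split => //.
- rewrite lcompA ltens_comp mid_r.
  have -> : lcomp e iotai = lcomp iotai f.
    by rewrite /f /z !lcompA iotaK mid_l.
  rewrite -{2}fh -{1}[idem _]mid_l -ltens_comp -lcompA.
  rewrite [X in lcomp _ X](_ : _ = lcomp (ltens (mid F N) f) (lcomp E h)).
    by rewrite Eh.
  by rewrite lcompA ltens_comp mid_l mid_r.
- split; first by rewrite -lcompA hmu.
  apply: contraNneq h0 => x0.
  by rewrite -[h]mid_l -mid_tens -{1}iotaiK -{1}[mid F N]mid_l -ltens_comp -lcompA x0 linear0.
rewrite /rtree lcompA ltens_comp mid_r -/f -[idem _]mid_l -[f]mid_r -ltens_comp -lcompA.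
by rewrite Eh fh.
Qed.
End RightTree.

Lemma content_row2 : content [:: 2%N] = 4.
Proof. by rewrite contentE !big_ord_recl !big_ord0; vm_compute. Qed.

Lemma content_col2 : content [:: 1%N; 1%N] = 0.
Proof. by rewrite contentE !big_ord_recl !big_ord0; vm_compute. Qed.

(** * Translation between the locked calculus and the tree definitions *)

Section Bridge.
Variable F : numFieldType.
Local Notation S := (simple_obj F).
Local Notation sq := (box F).

Lemma idem_tens (A B : obj F) : idem (tens A B) = ltens (idem A) (idem B).
Proof. by rewrite ltens.unlock. Qed.

Lemma hom_space_box (nu mu : seq nat)
    (x : mor F (fam1_pfam (sumn mu)) (famtens_pfam (fam1_pfam (sumn nu)) boxf)) :
  x \in hom_space (S mu) (tens (S nu) sq) <-> in_hom x.
Proof.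
split=> [/(@homP _ (S mu) (tens (S nu) sq))|[h1 h2]].
  by rewrite idem_tens simple1_idem.
by apply/(@homP _ (S mu) (tens (S nu) sq)); rewrite idem_tens simple1_idem.
Qed.

Lemma hom_space_box2 (la mu : seq nat)
    (x : mor F (fam1_pfam (sumn mu)) (famtens_pfam (fam1_pfam (sumn la)) boxf2)) :
  x \in hom_space (S mu) (tens (S la) (tens sq sq)) <-> in_hom x.
Proof.
have ee : idem (tens (S la) (tens sq sq)) = ltens (idem (S la)) (mid F boxf2).
  rewrite idem_tens [idem (tens sq sq)]idem_tens simple1_idem.
  by congr ltens; apply: mid_tens.
split=> [/(@homP _ (S mu) (tens (S la) (tens sq sq)))|[h1 h2]].
  by rewrite ee.
by apply/(@homP _ (S mu) (tens (S la) (tens sq sq))); rewrite ee.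
Qed.

Lemma left_treeP (la nu mu : seq nat)
    (v : mor F (fam1_pfam (sumn mu)) (famtens_pfam (fam1_pfam (sumn la)) boxf2)) :
  left_tree (S la) sq sq (S nu) (S mu) v <->
  exists (y : mor F (fam1_pfam (sumn nu)) (famtens_pfam (fam1_pfam (sumn la)) boxf))
    (x : mor F (fam1_pfam (sumn mu)) (famtens_pfam (fam1_pfam (sumn nu)) boxf)),
  [/\ in_hom y, in_hom x, y != 0, x != 0 & v = tree y x].
Proof.
have treeE y x : in_hom y -> mcomp (assoc (S la) sq sq) (mcomp (mtens y (idem sq)) x) =
    @tree F la nu mu y x.
  move=> [Ey _]; rewrite /assoc massocE /tree !idem_tens simple1_idem.
  rewrite lcomp.unlock ltens.unlock -!mcompA; congr mcomp.
  rewrite mcompA mtens_comp; congr mcomp; congr mtens.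
    by move: Ey; rewrite lcomp.unlock ltens.unlock.
  by have := mid_l (mid F boxf); rewrite lcomp.unlock.
split=> [[x [y [/hom_space_box hx x0 /hom_space_box hy y0 ->]]]|[y [x [hy hx y0 x0 ->]]]].
  by exists y, x; split => //; apply: treeE.
exists x, y; split=> //; try exact/hom_space_box.
by rewrite -treeE.
Qed.

Lemma right_treeP (la mu sh : seq nat)
    (w : mor F (fam1_pfam (sumn mu)) (famtens_pfam (fam1_pfam (sumn la)) boxf2)) :
  right_tree (S la) sq sq (S sh) (S mu) w <->
  exists (z : mor F (fam1_pfam (sumn sh)) boxf2)
    (x : mor F (fam1_pfam (sumn mu)) (famtens_pfam (fam1_pfam (sumn la)) (fam1_pfam (sumn sh)))),
  [/\ lcomp z (idem (S sh)) = z, z != 0, lcomp (ltens (idem (S la)) (idem (S sh))) x = x,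
      lcomp x (idem (S mu)) = x /\ x != 0 & w = rtree z x].
Proof.
have rE z x : mcomp (mtens (idem (S la)) z) x = @rtree F la mu sh z x.
  by rewrite /rtree lcomp.unlock ltens.unlock.
have ee : idem (tens sq sq) = mid F boxf2.
  by rewrite idem_tens simple1_idem; apply: mid_tens.
split=> [[x [z [/(@homP _ (S mu) (tens (S la) (S sh))) [h1 h2] x0
    /(@homP _ (S sh) (tens sq sq)) [_ h3] z0 ->]]]|[z [x [h1 z0 h2 [h3 x0] ->]]]].
  by exists z, x; split=> //; rewrite -idem_tens.
exists x, z; split=> //.
  by apply/(@homP _ (S mu) (tens (S la) (S sh))); rewrite idem_tens.
apply/(@homP _ (S sh) (tens sq sq)); split=> //.
by rewrite ee; apply: mid_l.
Qed.

Lemma g1_flip : g1 F = flip F.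
Proof.
rewrite /flip bmor.unlock /g1.
have -> : lshift 1 ord0 = ord0 :> 'I_(1 + 1) by apply: val_inj.
by have -> : rshift 1 ord0 = ord_max :> 'I_(1 + 1) by apply: val_inj.
Qed.

(** A vector of the Hom space absorbs e_la, so the idempotent on the left factor may be replaced by
    the identity. *)
Lemma g1_swap (la mu : seq nat)
    (w : mor F (fam1_pfam (sumn mu)) (famtens_pfam (fam1_pfam (sumn la)) boxf2)) :
  in_hom w -> mcomp (mtens (idem (S la)) (g1 F)) w = lcomp (swap F (sumn la)) w.
Proof.
move=> [Ew _]; rewrite -[in RHS]Ew lcompA swap_tens ltens_comp mid_l -/(flip F) mid_r.
by rewrite g1_flip lcomp.unlock ltens.unlock.
Qed.
End Bridge.

(** * Bases of planes and change of basis *)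

Section LinearAlgebra.
Variables (F : numFieldType) (V : vectType F).

Lemma basis_pair (U : {vspace V}) (v v' : V) : v \in U -> v' \in U ->
  (forall x y, x *: v + y *: v' = 0 -> x = 0 /\ y = 0) ->
  (forall u, u \in U -> exists x y, u = x *: v + y *: v') -> basis_of U [:: v; v'].
Proof.
move=> Uv Uv' indep sp; apply/andP; split.
  rewrite eqEsubv; apply/andP; split.
    by apply/span_subvP => u; rewrite !inE => /orP[] /eqP ->.
  apply/subvP => u /sp[x [y ->]].
  by apply: memvD; apply: memvZ; apply: memv_span; rewrite !inE eqxx ?orbT.
rewrite free_cons seq1_free span_seq1; apply/andP; split.
  apply/vlineP => -[c vE]; have [|/eqP] := indep 1 (- c).
    by rewrite scale1r vE scaleNr subrr.
  by rewrite oner_eq0.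
apply/eqP => v'0; have [|_ /eqP] := indep 0 1; last by rewrite oner_eq0.
by rewrite v'0 scale0r scaler0 addr0.
Qed.

(** Expanding v over w and then w over v shows that Q P fixes the coordinates of the free family v,
    so Q P = 1. *)
Lemma sixj_inv (v w : 2.-tuple V) (Q : 'M[F]_2) : free v ->
  (forall j, tnth v j \in <<w>>%VS) ->
  (forall i, tnth w i = \sum_l Q l i *: tnth v l) -> invmx (sixj v w) = Q.
Proof.
move=> free_v v_w wE; set P := sixj v w.
have QP : Q *m P = 1%:M.
  apply/matrixP => l j; rewrite !mxE.
  have vE : \sum_m ((Q *m P) m j - (m == j)%:R) *: v`_m = 0.
    under eq_bigr do rewrite scalerBl.
    rewrite sumrB [X in _ - X](bigD1 j) //= eqxx scale1r [X in _ - (_ + X)]big1 => [|m /negPf ->];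
      last by rewrite scale0r.
    rewrite addr0; apply/eqP; rewrite subr_eq0 -tnth_nth; apply/eqP.
    rewrite [RHS](coord_span (v_w j)).
    transitivity (\sum_i \sum_m (P i j * Q m i) *: tnth v m).
      rewrite exchange_big; apply: eq_bigr => m _; rewrite mxE -tnth_nth scaler_suml.
      by apply: eq_bigr => i _; rewrite mulrC.
    apply: eq_bigr => i _; rewrite -tnth_nth wE scaler_sumr.
    by apply: eq_bigr => m _; rewrite scalerA mxE.
  have /freeP/(_ _ vE l) := free_v; rewrite mxE => /eqP.
  by rewrite subr_eq0 => /eqP.
have [_ Pu] := mulmx1_unit QP.
by rewrite -[LHS]mul1mx -QP -mulmxA mulmxV // mulmx1.
Qed.

End LinearAlgebra.

(** * The two paths from [la] to [mu] and the 6j matrix *)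

Section Diamond.
Variables (F : numFieldType) (la nu nu' mu : seq nat) (r1 r2 : nat).
Hypotheses (box1 : add_box la nu r1) (box2 : add_box nu mu r2).
Hypotheses (box2' : add_box la nu' r2) (box1' : add_box nu' mu r1).
Hypothesis corner1 : forall r', (nth 0 la r1 < nth 0 la r')%N = (r' < r1)%N.
Hypothesis corner2 : forall r', (nth 0 nu r2 < nth 0 nu r')%N = (r' < r2)%N.
Hypothesis corner2' : forall r', (nth 0 la r2 < nth 0 la r')%N = (r' < r2)%N.
Hypothesis corner1' : forall r', (nth 0 nu' r1 < nth 0 nu' r')%N = (r' < r1)%N.
Hypothesis r12 : r1 != r2.
Variable k : F.
Hypothesis kE : k = ((nth 0%N la r1)%:R - r1%:R) - ((nth 0%N la r2)%:R - r2%:R).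
Hypotheses (k0 : k != 0) (kp : k + 1 != 0) (km : k - 1 != 0).
Local Notation S := (simple_obj F).
Local Notation sq := (box F).
Local Notation n := (sumn la).
Local Notation N := (fam1_pfam n).
Local Notation D := (fam1_pfam (sumn mu)).
Local Notation T := (famtens_pfam N boxf2).
Local Notation hom := (@in_hom F la mu boxf2).
Local Notation a := ((nth 0%N la r1)%:R - r1%:R : F).
Local Notation b := ((nth 0%N la r2)%:R - r2%:R : F).
Local Notation left_vec alpha := (left_tree (S la) sq sq (S alpha) (S mu)).
Local Notation right_vec beta := (right_tree (S la) sq sq (S beta) (S mu)).
Local Notation H := (hom_space (S mu) (tens (S la) (tens sq sq))).
Local Notation row2 := [:: 2%N].
Local Notation col2 := [:: 1%N; 1%N].

Let G : {linear mor F D T -> mor F D T} := lcomp (swap F n).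
Let J : {linear mor F D T -> mor F D T} := lcomp (jm F N (lshift 1 ord0 : 'I_(dg boxf2))).

Let ab : a != b. Proof. by rewrite -subr_eq0 -kE. Qed.

(** The second box has the same content whether it is added to [la] or to [nu]; this makes b the
    eigenvalue for the other path too. *)
Let nu_r2 : nth 0%N nu r2 = nth 0%N la r2.
Proof. by rewrite box1 (negPf r12). Qed.

Let GK w : G (G w) = w. Proof. by rewrite /G /= lcompA swapK mid_l. Qed.

Let G_hom w : hom w -> hom (G w). Proof. exact: hom_swap. Qed.

Let rel w : hom w -> J w + G (J (G w)) + G w = (a + b) *: w.
Proof. by move=> hw; have := swap_jm_rel box1 box2 corner1 corner2 hw; rewrite nu_r2. Qed.

Let left1 v : left_vec nu v -> [/\ hom v, v != 0 & J v = a *: v].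
Proof.
move=> /left_treeP[y [x [hy hx y0 x0 ->]]].
by split; [apply: tree_hom | apply: tree_neq0 | apply: tree_jm].
Qed.

Let left2 v : left_vec nu' v -> [/\ hom v, v != 0 & J v = b *: v].
Proof.
move=> /left_treeP[y [x [hy hx y0 x0 ->]]].
by split; [apply: tree_hom | apply: tree_neq0 | apply: tree_jm].
Qed.

Let left_exists alpha r s : add_box la alpha r -> add_box alpha mu s -> exists v, left_vec alpha v.
Proof.
move=> boxr boxs; have [y hy y0] := hom_box_neq0 F boxr; have [x hx x0] := hom_box_neq0 F boxs.
by exists (tree y x); apply/left_treeP; exists y, x.
Qed.

Let left_scale alpha c v : c != 0 -> left_vec alpha v -> left_vec alpha (c *: v).
Proof.
move=> c0 /left_treeP[y [x [hy [h1 h2] y0 x0 ->]]]; apply/left_treeP.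
exists y, (c *: x); split=> //; last by rewrite /tree !lcompZr.
  by split; [rewrite lcompZr h1 | rewrite lcompZl h2].
by rewrite scaler_eq0 negb_or c0.
Qed.

Let left_uniq alpha r s v1 v2 : add_box la alpha r -> add_box alpha mu s ->
  (forall r', (nth 0 la r < nth 0 la r')%N = (r' < r)%N) ->
  (forall r', (nth 0 alpha s < nth 0 alpha r')%N = (r' < s)%N) ->
  left_vec alpha v1 -> left_vec alpha v2 -> exists2 c, c != 0 & v2 = c *: v1.
Proof.
move=> boxr boxs cr cs /left_treeP[y [x [hy hx y0 x0 ->]]] /left_treeP[y' [x' [hy' hx' y'0 x'0 ->]]].
have [c y'E] := hom_box_dim boxr cr hy y0 hy'.
have [d x'E] := hom_box_dim boxs cs hx x0 hx'.
exists (c * d); last by rewrite /tree y'E x'E ltensZl !(lcompZl, lcompZr) scalerA.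
rewrite mulf_neq0 //.
  by apply: contraNneq y'0 => c0; rewrite y'E c0 scale0r.
by apply: contraNneq x'0 => d0; rewrite x'E d0 scale0r.
Qed.

Let right1 w : right_vec row2 w <-> [/\ hom w, w != 0 & G w = w].
Proof.
have e : (content row2)%:~R = 2%:R + 2%:R * 1 :> F by rewrite content_row2; ring.
split=> [/right_treeP[z [x [h1 z0 h2 [h3 x0] ->]]]|[hw w0 Gw]].
  split; [exact: rtree_hom | exact: (rtree_neq0 (erefl : sumn row2 = (1 + 1)%N) e) |].
  by apply: etrans (rtree_swap (erefl : sumn row2 = (1 + 1)%N) e _ _) _ => //; rewrite scale1r.
apply/right_treeP; apply: (rtree_exists (erefl : sumn row2 = (1 + 1)%N) e) => //.
by rewrite scale1r.
Qed.

Let right2 w : right_vec col2 w <-> [/\ hom w, w != 0 & G w = - w].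
Proof.
have e : (content col2)%:~R = 2%:R + 2%:R * -1 :> F by rewrite content_col2; ring.
split=> [/right_treeP[z [x [h1 z0 h2 [h3 x0] ->]]]|[hw w0 Gw]].
  split; [exact: rtree_hom | exact: (rtree_neq0 (erefl : sumn col2 = (1 + 1)%N) e) |].
  by apply: etrans (rtree_swap (erefl : sumn col2 = (1 + 1)%N) e _ _) _ => //; rewrite scaleN1r.
apply/right_treeP; apply: (rtree_exists (erefl : sumn col2 = (1 + 1)%N) e) => //.
by rewrite scaleN1r.
Qed.

Let span1 v : left_vec nu v -> forall h, hom h -> exists x y, h = x *: v + y *: G v.
Proof.
move=> /left1[hv v0 Jv].
exact: (tree_span box1 box2 corner1 corner2 hv v0 Jv).
Qed.

Lemma left_basis v v' : left_vec nu v -> left_vec nu' v' -> basis_of H [:: v; v'].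
Proof.
move=> lv lv'; have [hv v0 Jv] := left1 lv; have [hv' v'0 Jv'] := left2 lv'.
apply: basis_pair; try exact/hom_space_box2.
  by move=> x y; apply: (eigen_indep v0 v'0 Jv Jv' ab).
move=> h /hom_space_box2 hh.
exact: (eigen_span hv' v0 v'0 Jv Jv' ab (span1 lv) hh).
Qed.

Let seminormal v v' : hom v -> hom v' ->
  g1_seminormal (S la) (S mu) k [tuple v; v'] <->
  G v = - k^-1 *: v + (1 - k^-2) *: v' /\ G v' = v + k^-1 *: v'.
Proof.
move=> hv hv'; have gv := g1_swap hv; have gv' := g1_swap hv'.
split=> [sn|[Gv Gv'] j].
  split.
    have := sn ord0; rewrite (tnth_nth 0) /= gv => ->.
    by rewrite big_ord_recl big_ord1 !(tnth_nth 0) !mxE /=.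
  have := sn ord_max; rewrite (tnth_nth 0) /= gv' => ->.
  by rewrite big_ord_recl big_ord1 !(tnth_nth 0) !mxE /= scale1r.
rewrite big_ord_recl big_ord1 !(tnth_nth 0) !mxE /=.
case: j => [[|[|//]] j2] /=; first by rewrite gv.
by rewrite gv' scale1r.
Qed.

Lemma seminormal_exists : exists v v', [/\ left_vec nu v, left_vec nu' v'
  & g1_seminormal (S la) (S mu) k [tuple v; v']].
Proof.
have [v lv] := left_exists box1 box2; have [v' lv'] := left_exists box2' box1'.
have [hv v0 Jv] := left1 lv; have [hv' v'0 Jv'] := left2 lv'.
have [q [r [Gv Gv']]] := eigen_involution GK G_hom rel hv hv' v0 v'0 Jv Jv' ab (span1 lv).
rewrite -kE in Gv Gv' * => qr.
(* If r = 0 then 1 - 1/k^2 = q r vanishes, forcing k = 1 or k = -1. *)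
have r0 : r != 0.
  apply: contraTneq isT => r0; have /eqP : (k - 1) * (k + 1) = 0.
    have : (1 - k^-2) * k ^+ 2 = 0 by rewrite -qr r0 mulr0 mul0r.
    by move=> <-; field.
  by rewrite mulf_eq0 (negPf kp) (negPf km).
have lrv : left_vec nu (r *: v) by apply: left_scale.
have [hrv _ _] := left1 lrv.
(* Scaling v by r turns the coefficient r of v in G v' into 1 and the coefficient q of v' in G v
   into q r = 1 - 1/k^2. *)
exists (r *: v), v'; split=> //; apply/seminormal => //; split=> //.
by rewrite linearZ /= Gv scalerDr !scalerA mulrC [r * q]mulrC qr.
Qed.

Section Normalized.
Variables v v' : mor F D T.
Hypotheses (lv : left_vec nu v) (lv' : left_vec nu' v').
Hypothesis sn : g1_seminormal (S la) (S mu) k [tuple v; v'].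
Local Notation w := ((k / (k + 1)) *: v + v').
Local Notation w' := ((- k / (k - 1)) *: v + v').

Let hv : hom v. Proof. by have [] := left1 lv. Qed.
Let hv' : hom v'. Proof. by have [] := left2 lv'. Qed.
Let v0 : v != 0. Proof. by have [] := left1 lv. Qed.
Let v'0 : v' != 0. Proof. by have [] := left2 lv'. Qed.
Let Jv : J v = a *: v. Proof. by have [] := left1 lv. Qed.
Let Jv' : J v' = b *: v'. Proof. by have [] := left2 lv'. Qed.

Let Gv : G v = - (a - b)^-1 *: v + (1 - (a - b)^-2) *: v'.
Proof. by rewrite -kE; have /(seminormal hv hv')[] := sn. Qed.

Let Gv' : G v' = v + (a - b)^-1 *: v'.
Proof. by rewrite -kE; have /(seminormal hv hv')[] := sn. Qed.

Let w_neq0 x : x *: v + v' != 0.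
Proof.
apply/eqP => w0; have [|_ /eqP] := eigen_indep v0 v'0 Jv Jv' ab (x := x) (y := 1).
  by rewrite scale1r.
by rewrite oner_eq0.
Qed.

Lemma right_plus : right_vec row2 w.
Proof.
apply/right1; split; [exact: hom_lin | exact: w_neq0 |].
rewrite kE; apply: (seminormal_plus ab Gv Gv').
by rewrite -kE.
Qed.

Lemma right_minus : right_vec col2 w'.
Proof.
apply/right2; split; [exact: hom_lin | exact: w_neq0 |].
rewrite kE; apply: (seminormal_minus ab Gv Gv').
by rewrite -kE.
Qed.

Lemma right_plus_uniq u : right_vec row2 u -> exists2 c, c != 0 & u = c *: w.
Proof.
move=> /right1[hu u0 Gu].
have [|c uE] := seminormal_plus_uniq hv' v0 v'0 Jv Jv' ab (span1 lv) Gv Gv' _ hu Gu.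
  by rewrite -kE.
rewrite -kE in uE; exists c => //.
by apply: contraNneq u0 => c0; rewrite uE c0 scale0r.
Qed.

Lemma right_minus_uniq u : right_vec col2 u -> exists2 c, c != 0 & u = c *: w'.
Proof.
move=> /right2[hu u0 Gu].
have [|c uE] := seminormal_minus_uniq hv' v0 v'0 Jv Jv' ab (span1 lv) Gv Gv' _ hu Gu.
  by rewrite -kE.
rewrite -kE in uE; exists c => //.
by apply: contraNneq u0 => c0; rewrite uE c0 scale0r.
Qed.
End Normalized.

Lemma right_basis w w' : right_vec row2 w -> right_vec col2 w' -> basis_of H [:: w; w'].
Proof.
move=> /right1[hw w0 Gw] /right2[hw' w'0 Gw'].
have [v [v' [lv lv' _]]] := seminormal_exists.
(* The dimension 2 is read off a left basis, so independence of w and w' suffices. *)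
have dimH := size_basis (left_basis lv lv').
rewrite basisEfree dimH leqnn andbT; apply/andP; split; last first.
  by apply/span_subvP => u; rewrite !inE => /orP[] /eqP ->; apply/hom_space_box2.
rewrite free_cons seq1_free w'0 andbT span_seq1; apply/vlineP => -[c wE].
(* A multiple of w' is negated by G, so w = - w, impossible in characteristic 0. *)
have := Gw; rewrite wE linearZ /= Gw' scalerN => /eqP; rewrite eq_sym -addr_eq0 -mulr2n.
by rewrite -wE -scaler_nat scaler_eq0 pnatr_eq0 (negPf w0).
Qed.

Lemma sixj_diamond v v' w w' : left_vec nu v -> left_vec nu' v' ->
  right_vec row2 w -> right_vec col2 w' ->
  forall Q : 'M_2, w = Q ord0 ord0 *: v + Q ord_max ord0 *: v' ->
    w' = Q ord0 ord_max *: v + Q ord_max ord_max *: v' ->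
  invmx (sixj [tuple v; v'] [tuple w; w']) = Q.
Proof.
move=> lv lv' rw rw' Q wE w'E.
have bv := left_basis lv lv'; have bw := right_basis rw rw'.
apply: sixj_inv; first exact: basis_free bv.
  move=> j; rewrite (span_basis bw).
  by apply: (basis_mem bv); apply: mem_tnth.
move=> i; rewrite big_ord_recl big_ord1 !(tnth_nth 0) /=.
have e : lift ord0 ord0 = ord_max :> 'I_2 by apply: val_inj.
rewrite e; case: (unliftP ord0 i) => [j ->|-> //].
by rewrite [j]ord1 e.
Qed.

Local Notation jinv := (mx22 (k / (k + 1)) (- k / (k - 1)) 1 1).

Lemma normalized_right v v' : left_vec nu v -> left_vec nu' v' ->
  g1_seminormal (S la) (S mu) k [tuple v; v'] ->
  exists w w', [/\ right_vec row2 w, right_vec col2 w',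
    invmx (sixj [tuple v; v'] [tuple w; w']) = jinv,
    w = (k / (k + 1)) *: v + v' & w' = (- k / (k - 1)) *: v + v'].
Proof.
move=> lv lv' sn; have rw := right_plus lv lv' sn; have rw' := right_minus lv lv' sn.
exists ((k / (k + 1)) *: v + v'), ((- k / (k - 1)) *: v + v'); split=> //.
by apply: sixj_diamond => //; rewrite !mxE /= scale1r.
Qed.

Lemma left_vec_uniq alpha v1 v2 : alpha \in [:: nu; nu'] ->
  left_vec alpha v1 -> left_vec alpha v2 -> exists2 c, c != 0 & v2 = c *: v1.
Proof.
rewrite !inE => /orP[] /eqP ->.
  exact: left_uniq box1 box2 corner1 corner2.
exact: left_uniq box2' box1' corner2' corner1'.
Qed.

Lemma right_vec_uniq beta w1 w2 : beta \in [:: row2; col2] ->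
  right_vec beta w1 -> right_vec beta w2 -> exists2 c, c != 0 & w2 = c *: w1.
Proof.
have [v [v' [lv lv' sn]]] := seminormal_exists.
have uniq (w : mor F D T) c1 c2 : c1 != 0 -> c2 != 0 ->
    exists2 c, c != 0 & c2 *: w = c *: (c1 *: w).
  move=> c10 c20; exists (c2 / c1); first by rewrite mulf_neq0 ?invr_eq0.
  by rewrite scalerA divfK.
rewrite !inE => /orP[] /eqP ->.
  move=> /(right_plus_uniq lv lv' sn)[c1 c10 ->] /(right_plus_uniq lv lv' sn)[c2 c20 ->].
  exact: uniq.
move=> /(right_minus_uniq lv lv' sn)[c1 c10 ->] /(right_minus_uniq lv lv' sn)[c2 c20 ->].
exact: uniq.
Qed.

(** The left diagonal collects the scalars taking v, v' to a seminormal pair, the right one those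
    taking the resulting right trees to w, w'. *)
Lemma sixj_diag v v' w w' : left_vec nu v -> left_vec nu' v' ->
  right_vec row2 w -> right_vec col2 w' ->
  exists dl dr : 'rV[F]_2, [/\ diag_mx dl \in unitmx, diag_mx dr \in unitmx
    & invmx (sixj [tuple v; v'] [tuple w; w']) = diag_mx dl *m jinv *m diag_mx dr].
Proof.
move=> lv lv' rw rw'; have [v0 [v0' [lv0 lv0' sn]]] := seminormal_exists.
have [c c0 v0E] := left_vec_uniq (mem_head _ _) lv lv0.
have nu'_in : nu' \in [:: nu; nu'] by rewrite !inE eqxx orbT.
have [c' c'0 v0'E] := left_vec_uniq nu'_in lv' lv0'.
have [d d0 wE] := right_plus_uniq lv0 lv0' sn rw.
have [d' d'0 w'E] := right_minus_uniq lv0 lv0' sn rw'.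
have unit_diag (x y : F) : x != 0 -> y != 0 ->
    diag_mx (\row_(i < 2) [:: x; y]`_i) \in unitmx.
  move=> x0 y0; rewrite unitmxE det_diag big_ord_recl big_ord1 !mxE /=.
  by rewrite unitfE mulf_neq0.
exists (\row_(i < 2) [:: c; c']`_i), (\row_(i < 2) [:: d; d']`_i).
split; try exact: unit_diag.
apply: sixj_diamond => //; rewrite mul_mx_diag mul_diag_mx !mxE /=.
  rewrite wE v0E v0'E scalerDr !scalerA; congr (_ *: _ + _ *: _); ring.
rewrite w'E v0E v0'E scalerDr !scalerA; congr (_ *: _ + _ *: _); ring.
Qed.

End Diamond.

(** * Row lengths of the intermediate partitions *)

Definition nonincreasing_rows sh := forall i j, (i <= j)%N -> (nth 0 sh j <= nth 0 sh i)%N.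

Lemma partition_rows sh : is_partition sh -> nonincreasing_rows sh.
Proof.
move=> /andP[sh_sorted _] i j ij; have [lt_j|le_j] := ltnP j (size sh); last first.
  by rewrite nth_default.
apply: (sorted_leq_nth _ _ 0%N sh_sorted) => //; last exact: leq_ltn_trans ij lt_j.
  by move=> x y z /= yx zy; apply: leq_trans zy yx.
by move=> x /=.
Qed.

(** A row above r must be strictly longer than row r, or the new box would stick out in sh'; a row
    from r on is no longer than row r. *)
Lemma corner_of_rows sh sh' r : nonincreasing_rows sh -> nonincreasing_rows sh' ->
  add_box sh sh' r -> forall r', (nth 0 sh r < nth 0 sh r')%N = (r' < r)%N.
Proof.
move=> dsh dsh' box r'; apply/idP/idP => [|lt_r].
  by apply: contraTT; rewrite -!leqNgt => /dsh.
have := dsh' _ _ (ltnW lt_r); rewrite !box eqxx add1n.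
by rewrite (gtn_eqF lt_r).
Qed.

Lemma add_box_incr_nth sh r : add_box sh (incr_nth sh r) r.
Proof. by move=> r'; rewrite nth_incr_nth. Qed.

Section SkewPair.
Variables (la mu : seq nat) (r1 c1 r2 c2 : nat).
Hypotheses (la_rows : nonincreasing_rows la) (mu_rows : nonincreasing_rows mu).
Hypothesis la_mu : {subset diagram la <= diagram mu}.
Hypothesis two_boxes : forall b : nat * nat,
  (b \in diagram mu) && (b \notin diagram la) <-> b = (r1, c1) \/ b = (r2, c2).
Hypotheses (lt_r : (r1 < r2)%N) (lt_c : (c2 < c1)%N).

Let in_diag sh r c : ((r, c) \in diagram sh) = (c < nth 0 sh r)%N. Proof. by []. Qed.

Let le_rows r : (nth 0 la r <= nth 0 mu r)%N.
Proof.
by rewrite leqNgt; apply/negP => lt; have := la_mu (x := (r, nth 0%N mu r)) lt; rewrite in_diag ltnn.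
Qed.

Let box_at r c : c = nth 0%N la r -> (c < nth 0 mu r)%N -> (r, c) = (r1, c1) \/ (r, c) = (r2, c2).
Proof. by move=> -> lt; apply/two_boxes; rewrite !in_diag lt ltnn. Qed.

(** The two boxes lie in different rows, so a row contains at most one of them, and it sits just
    past the end of the row of [la]. *)
Let row_in r c : (r, c) = (r1, c1) \/ (r, c) = (r2, c2) ->
  nth 0%N la r = c /\ nth 0%N mu r = c.+1.
Proof.
move=> rc; have /two_boxes := rc; rewrite !in_diag -leqNgt => /andP[lt_mu le_la].
have uniq c' : (r, c') = (r1, c1) \/ (r, c') = (r2, c2) -> c' = c.
  by case: rc => -[-> ->] [] [] //; lia.
have cE : nth 0%N la r = c.
  by apply: uniq; apply: box_at => //; apply: leq_ltn_trans lt_mu.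
split=> //; apply/eqP; rewrite eqn_leq lt_mu andbT leqNgt; apply/negP => lt.
have /uniq : (r, c.+1) = (r1, c1) \/ (r, c.+1) = (r2, c2).
  by apply/two_boxes; rewrite !in_diag lt cE -leqNgt leqnSn.
by lia.
Qed.

Lemma skew_row1 : nth 0%N la r1 = c1 /\ nth 0%N mu r1 = c1.+1.
Proof. by apply: row_in; left. Qed.

Lemma skew_row2 : nth 0%N la r2 = c2 /\ nth 0%N mu r2 = c2.+1.
Proof. by apply: row_in; right. Qed.

Lemma skew_rows r : nth 0%N mu r = ((r1 == r) + (r2 == r) + nth 0%N la r)%N.
Proof.
have [la1 mu1] := skew_row1; have [la2 mu2] := skew_row2.
have [<-|r1r] := eqVneq r1 r; first by rewrite gtn_eqF // mu1 la1.
have [<-|r2r] := eqVneq r2 r; first by rewrite mu2 la2.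
apply/eqP; rewrite eqn_leq le_rows andbT leqNgt; apply/negP => lt.
by have [] := box_at erefl lt => -[] /eqP; rewrite eq_sym ?(negPf r1r) ?(negPf r2r).
Qed.

(** The rows above r1 agree with those of [mu], where they already dominate the lengthened row
    r1. *)
Lemma upper_rows : nonincreasing_rows (incr_nth la r1).
Proof.
move=> i j ij; rewrite !nth_incr_nth.
have := mu_rows ij; have := la_rows ij; rewrite !skew_rows.
by do 4!case: eqP => ? /=; lia.
Qed.

(** Rows above r2 other than r1 agree with those of [mu]; row r1 still has length c1, and c2 < c1
    leaves room for the new box. *)
Lemma lower_rows : nonincreasing_rows (incr_nth la r2).
Proof.
have [la1 mu1] := skew_row1; have [la2 mu2] := skew_row2.
move=> i j ij; rewrite !nth_incr_nth.
have := mu_rows ij; have := la_rows ij; rewrite !skew_rows.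
have [e1|_] := eqVneq r1 i; have [e2|_] := eqVneq r2 j; have [e3|_] := eqVneq r2 i;
  have [e4|_] := eqVneq r1 j; subst; lia.
Qed.

End SkewPair.

Unset Implicit Arguments.

Theorem theorem1 (R : realType) (la mu : seq nat) (r1 c1 r2 c2 : nat)
    (la_part : is_partition la) (mu_part : is_partition mu)
    (la_mu : {subset diagram la <= diagram mu})
    (two_boxes : forall b : nat * nat,
       (b \in diagram mu) && (b \notin diagram la) <->
       b = (r1, c1) \/ b = (r2, c2))
    (lt_r : (r1 < r2)%N) (lt_c : (c2 < c1)%N) :
  let k : R[i] := ((r2 - r1) + (c1 - c2))%N%:R in
  let S := simple_obj R[i] in
  let sq := box R[i] in
  (* incr_nth la r adds one box at the end of row r *)
  let nu := incr_nth la r1 in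
  let nu' := incr_nth la r2 in
  let left_vec := fun alpha => left_tree (S la) sq sq (S alpha) (S mu) in
  let right_vec := fun beta => right_tree (S la) sq sq (S beta) (S mu) in
  let H := hom_space (S mu) (tens (S la) (tens sq sq)) in
  let jinv := mx22 (k / (k + 1)) (- k / (k - 1)) 1 1 in
  [/\ forall v v', left_vec nu v -> left_vec nu' v' -> basis_of H [:: v; v'],
      forall w w', right_vec [:: 2%N] w -> right_vec [:: 1%N; 1%N] w' ->
        basis_of H [:: w; w'],
      exists v v', [/\ left_vec nu v, left_vec nu' v'
        & g1_seminormal (S la) (S mu) k [tuple v; v']],
      forall v v', left_vec nu v -> left_vec nu' v' ->
        g1_seminormal (S la) (S mu) k [tuple v; v'] ->
        exists w w', [/\ right_vec [:: 2%N] w, right_vec [:: 1%N; 1%N] w',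
          invmx (sixj [tuple v; v'] [tuple w; w']) = jinv,
          w = (k / (k + 1)) *: v + v'
          & w' = (- k / (k - 1)) *: v + v']
    & (forall alpha v1 v2, alpha \in [:: nu; nu'] ->
         left_vec alpha v1 -> left_vec alpha v2 ->
         exists2 a : R[i], a != 0 & v2 = a *: v1) /\
      (forall beta w1 w2, beta \in [:: [:: 2%N]; [:: 1%N; 1%N]] ->
         right_vec beta w1 -> right_vec beta w2 ->
         exists2 a : R[i], a != 0 & w2 = a *: w1) /\
      (forall v v' w w', left_vec nu v -> left_vec nu' v' ->
         right_vec [:: 2%N] w -> right_vec [:: 1%N; 1%N] w' ->
         exists dl dr : 'rV[R[i]]_2,
           [/\ diag_mx dl \in unitmx, diag_mx dr \in unitmx
             & invmx (sixj [tuple v; v'] [tuple w; w']) =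
               diag_mx dl *m jinv *m diag_mx dr])].
Proof.
move=> k S sq nu nu' left_vec right_vec H jinv.
have la_rows := partition_rows la_part; have mu_rows := partition_rows mu_part.
have nu_rows : nonincreasing_rows nu by apply: upper_rows two_boxes lt_r lt_c.
have nu'_rows : nonincreasing_rows nu' by apply: lower_rows two_boxes lt_r lt_c.
have muE := skew_rows la_mu two_boxes lt_r lt_c.
have box1 : add_box la nu r1 by apply: add_box_incr_nth.
have box2' : add_box la nu' r2 by apply: add_box_incr_nth.
have box2 : add_box nu mu r2 by move=> r; rewrite muE box1 addnCA addnA.
have box1' : add_box nu' mu r1 by move=> r; rewrite muE box2' addnA.
have corner1 := corner_of_rows la_rows nu_rows box1.
have corner2 := corner_of_rows nu_rows mu_rows box2.
have corner2' := corner_of_rows la_rows nu'_rows box2'.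
have corner1' := corner_of_rows nu'_rows mu_rows box1'.
have r12 : r1 != r2 by rewrite ltn_eqF.
have [la1 _] := skew_row1 two_boxes lt_r lt_c.
have [la2 _] := skew_row2 two_boxes lt_r lt_c.
(* The axial distance is a difference of contents; the truncated subtractions in [k] are exact
   because r1 < r2 and c2 < c1. *)
have kE : k = ((nth 0%N la r1)%:R - r1%:R) - ((nth 0%N la r2)%:R - r2%:R).
  by rewrite la1 la2 /k natrD !natrB ?(ltnW lt_r) ?(ltnW lt_c) //; ring.
have k0 : k != 0 by rewrite pnatr_eq0; lia.
have kp : k + 1 != 0 by rewrite /k natr1 pnatr_eq0.
(* Both summands of [k] are at least 1, so k is at least 2. *)
have km : k - 1 != 0.
  by rewrite subr_eq0 /k (eqr_nat _ _ 1); lia.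
split.
- exact: (@left_basis R[i] la nu nu' mu r1 r2 box1 box2 box2' corner1 corner2 corner2' k kE k0).
- exact: (@right_basis R[i] la nu nu' mu r1 r2 box1 box2 box2'
    box1' corner1 corner2 corner2' r12 k kE k0 kp km).
- exact: (@seminormal_exists R[i] la nu nu' mu r1 r2 box1 box2 box2'
    box1' corner1 corner2 corner2' r12 k kE k0 kp km).
- exact: (@normalized_right R[i] la nu nu' mu r1 r2 box1 box2 box2'
    box1' corner1 corner2 corner2' r12 k kE k0 kp km).
split; first exact: (@left_vec_uniq R[i] la nu nu' mu r1 r2 box1 box2 box2'
    box1' corner1 corner2 corner2' corner1').
split; first exact: (@right_vec_uniq R[i] la nu nu' mu r1 r2 box1 box2 box2'
    box1' corner1 corner2 corner2' r12 k kE k0 kp km).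
exact: (@sixj_diag R[i] la nu nu' mu r1 r2 box1 box2 box2'
    box1' corner1 corner2 corner2' corner1' r12 k kE k0 kp km).
Qed.
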